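(* Let $S$ be an inverse semigroup. Then the Stone groupoid of the Exel completion $\mathsf{T}(S)$ of $S$ is the tight groupoid $\mathsf{G}_{t}(S)$.
   Context: Conventions: inverse semigroups have a zero and homomorphisms preserve it; the order is the natural partial order, $\mathbf{d}(s)=s^{-1}s$, $\mathbf{r}(s)=ss^{-1}$, and $X^{\uparrow}$, $X^{\downarrow}$ denote the upward and downward closures of a subset $X$. A Boolean inverse semigroup is an inverse semigroup with joins of finite compatible sets over which multiplication distributes, whose idempotents form a (generalized, not necessarily unital) Boolean algebra. A finite subset $\{a_{1},\ldots,a_{m}\}\subseteq a^{\downarrow}$ is a cover of $a$ if for each $0\neq x\leq a$ there is $i$ with $x\wedge a_{i}\neq 0$. The Booleanization $\mathsf{B}(S)$ is the Boolean inverse semigroup together with the (injective) homomorphism $\beta\colon S\to\mathsf{B}(S)$ that is universal for homomorphisms from $S$ to Boolean inverse semigroups; identify $S$ with its image. An additive ideal is a semigroup ideal closed under binary compatible joins. The Cuntz–Krieger ideal $I$ of $\mathsf{B}(S)$ is the additive ideal generated by all elements $a\setminus(a_{1}\vee\cdots\vee a_{m})$ where $\{a_{1},\ldots,a_{m}\}$ is a cover of $a$. The Exel completion is $\mathsf{T}(S)=\mathsf{B}(S)/I$, the quotient by the congruence $(a,b)\in\varepsilon_{I}$ iff there is $c\leq a,b$ with $a\setminus c,\ b\setminus c\in I$. The Stone groupoid of a Boolean inverse semigroup $T$ is the set of ultrafilters of $T$ with product $A\cdot B=(AB)^{\uparrow}$ defined when $(A^{-1}A)^{\uparrow}=(BB^{-1})^{\uparrow}$,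 and topology with basis the sets of ultrafilters containing a fixed element $a\in T$. A proper filter of $S$ is a non-empty upward-closed, down-directed subset not containing $0$; it is tight if whenever $a\in A$ and $C$ is a cover of $a$ then $C\cap A\neq\varnothing$. The tight groupoid $\mathsf{G}_{t}(S)$ (Exel's tight groupoid) is the groupoid of tight filters of $S$ with the same partial product, equipped with the patch topology, whose basic open sets are the sets of tight filters containing $a$ but none of $a_{1},\ldots,a_{m}$ (for $a_{1},\ldots,a_{m}\leq a$). *)

(* Defs.v *)
From Stdlib Require Import List.
Import ListNotations.

Record ISG := {
  car :> Type;
  smul : car -> car -> car;
  szero : car;
  sinv : car -> car;
  smulA : forall x y z, smul x (smul y z) = smul (smul x y) z;
  smul0l : forall x, smul szero x = szero;
  smul0r : forall x, smul x szero = szero;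
  sinv_l : forall x, smul (smul x (sinv x)) x = x;
  sinv_r : forall x, smul (smul (sinv x) x) (sinv x) = sinv x;
  sinv_uniq : forall x y, smul (smul x y) x = x -> smul (smul y x) y = y -> y = sinv x
}.

Arguments smul {_} _ _.
Arguments szero {_}.
Arguments sinv {_} _.

Section Basic.
Variable S : ISG.

Definition dom (s : S) : S := smul (sinv s) s.
Definition ran (s : S) : S := smul s (sinv s).

Definition leq (s t : S) : Prop := s = smul t (dom s).

Definition idem (e : S) : Prop := smul e e = e.

Definition compatible (s t : S) : Prop :=
  idem (smul (sinv s) t) /\ idem (smul s (sinv t)).

Definition orthogonal (s t : S) : Prop :=
  smul (sinv s) t = szero /\ smul s (sinv t) = szero.

Definition compat_list (X : list S) : Prop :=
  forall x y, In x X -> In y X -> compatible x y.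

Definition is_join (X : list S) (a : S) : Prop :=
  (forall x, In x X -> leq x a) /\
  (forall b, (forall x, In x X -> leq x b) -> leq a b).

Definition Boolean : Prop :=
  (forall X, compat_list X -> exists a, is_join X a) /\
  (forall X a s, compat_list X -> is_join X a ->
      is_join (map (fun x => smul s x) X) (smul s a) /\
      is_join (map (fun x => smul x s) X) (smul a s)) /\
  (* idempotents form a generalized Boolean algebra: E(S) is a distributive
     lattice with 0 (meets = products, joins and distributivity by the two
     clauses above) with relative complements *)
  (forall e f, idem e -> idem f -> leq e f ->
      exists g, idem g /\ smul e g = szero /\ is_join [e; g] f).

Definition rel_diff (a c x : S) : Prop :=
  leq c a /\ leq x a /\ orthogonal x c /\ is_join [x; c] a.

Definition additive_ideal (J : S -> Prop) : Prop :=
  (forall x s, J x -> J (smul s x) /\ J (smul x s)) /\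
  (forall x y z, J x -> J y -> compatible x y -> is_join [x; y] z -> J z).

Definition cover (a : S) (X : list S) : Prop :=
  (forall x, In x X -> leq x a) /\
  (forall x, x <> szero -> leq x a ->
     exists ai, In ai X /\ exists y, y <> szero /\ leq y x /\ leq y ai).

Definition proper_filter (F : S -> Prop) : Prop :=
  (exists x, F x) /\
  (forall x y, F x -> leq x y -> F y) /\
  (forall x y, F x -> F y -> exists z, F z /\ leq z x /\ leq z y) /\
  ~ F szero.

Definition ultrafilter (F : S -> Prop) : Prop :=
  proper_filter F /\
  forall G, proper_filter G -> (forall x, F x -> G x) -> forall x, G x -> F x.

Definition tight_filter (F : S -> Prop) : Prop :=
  proper_filter F /\
  forall a X, F a -> cover a X -> exists c, In c X /\ F c.

Definition same (A B : S -> Prop) : Prop := forall x, A x <-> B x.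

Definition fprod (A B : S -> Prop) : S -> Prop :=
  fun x => exists a b, A a /\ B b /\ leq (smul a b) x.

Definition finv (A : S -> Prop) : S -> Prop := fun x => A (sinv x).

Definition composable (A B : S -> Prop) : Prop :=
  same (fprod (finv A) A) (fprod B (finv B)).

Definition stone_open (U : (S -> Prop) -> Prop) : Prop :=
  forall A, ultrafilter A -> U A ->
    exists a, A a /\ forall B, ultrafilter B -> B a -> U B.

Definition patch_basic (a : S) (X : list S) (F : S -> Prop) : Prop :=
  F a /\ forall x, In x X -> ~ F x.

Definition patch_open (U : (S -> Prop) -> Prop) : Prop :=
  forall F, tight_filter F -> U F ->
    exists a X, (forall x, In x X -> leq x a) /\ patch_basic a X F /\
      forall G, tight_filter G -> patch_basic a X G -> U G.

End Basic.

Arguments dom {_} _.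
Arguments ran {_} _.
Arguments leq {_} _ _.
Arguments idem {_} _.
Arguments compatible {_} _ _.
Arguments orthogonal {_} _ _.
Arguments compat_list {_} _.
Arguments is_join {_} _ _.
Arguments rel_diff {_} _ _ _.
Arguments additive_ideal {_} _.
Arguments cover {_} _ _.
Arguments proper_filter {_} _.
Arguments ultrafilter {_} _.
Arguments tight_filter {_} _.
Arguments same {_} _ _.
Arguments fprod {_} _ _ _.
Arguments finv {_} _ _.
Arguments composable {_} _ _.
Arguments stone_open {_} _.
Arguments patch_basic {_} _ _ _.
Arguments patch_open {_} _.

Definition hom {S T : ISG} (f : S -> T) : Prop :=
  (forall x y, f (smul x y) = smul (f x) (f y)) /\ f szero = szero.

Definition additive_hom {S T : ISG} (f : S -> T) : Prop :=
  hom f /\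
  forall x y z, compatible x y -> is_join [x; y] z -> is_join [f x; f y] (f z).

Definition is_booleanization (S B : ISG) (beta : S -> B) : Prop :=
  Boolean B /\ hom beta /\ (forall x y, beta x = beta y -> x = y) /\
  forall (C : ISG), Boolean C -> forall theta : S -> C, hom theta ->
    exists phi : B -> C, additive_hom phi /\ (forall s, phi (beta s) = theta s) /\
      forall phi' : B -> C, additive_hom phi' -> (forall s, phi' (beta s) = theta s) ->
        forall b, phi' b = phi b.

Definition CK_gen {S B : ISG} (beta : S -> B) (x : B) : Prop :=
  exists (a : S) (X : list S) (c : B),
    cover a X /\ is_join (map beta X) c /\ rel_diff (beta a) c x.

Definition CK_ideal {S B : ISG} (beta : S -> B) (x : B) : Prop :=
  forall J : B -> Prop, additive_ideal J -> (forall g, CK_gen beta g -> J g) -> J x.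

Definition eps_I {S B : ISG} (beta : S -> B) (a b : B) : Prop :=
  exists c, leq c a /\ leq c b /\
    (exists x, rel_diff a c x /\ CK_ideal beta x) /\
    (exists y, rel_diff b c y /\ CK_ideal beta y).

(* T together with q : B -> T is (a presentation of) the Exel completion
   T(S) = B(S)/I: q is a surjective homomorphism with kernel eps_I. *)
Definition exel_completion (S B : ISG) (beta : S -> B) (T : ISG) (q : B -> T) : Prop :=
  is_booleanization S B beta /\ hom q /\ (forall t, exists b, q b = t) /\
  forall a b, q a = q b <-> eps_I beta a b.

(* The Stone groupoid of T is isomorphic, as a topological groupoid, to the
   tight groupoid of S. Filters are predicates, identified up to [same]. *)
Definition stone_tight_iso (S T : ISG) : Prop :=
  exists (Phi : (T -> Prop) -> (S -> Prop)) (Psi : (S -> Prop) -> (T -> Prop)),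
    (forall A, ultrafilter A -> tight_filter (Phi A)) /\
    (forall F, tight_filter F -> ultrafilter (Psi F)) /\
    (forall A A', same A A' -> same (Phi A) (Phi A')) /\
    (forall F F', same F F' -> same (Psi F) (Psi F')) /\
    (forall A, ultrafilter A -> same (Psi (Phi A)) A) /\
    (forall F, tight_filter F -> same (Phi (Psi F)) F) /\
    (forall A B, ultrafilter A -> ultrafilter B ->
       (composable A B <-> composable (Phi A) (Phi B))) /\
    (forall A B, ultrafilter A -> ultrafilter B -> composable A B ->
       same (Phi (fprod A B)) (fprod (Phi A) (Phi B))) /\
    (forall a X, (forall x, In x X -> leq x a) ->
       stone_open (fun A => patch_basic a X (Phi A))) /\
    (* Psi continuous: preimages of basic Stone-open sets are open *)
    (forall t : T, patch_open (fun F => Psi F t)).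

(* Main.v *)
(* Write E(S) for the idempotents of S.  A proper filter A of an inverse
   semigroup is the upward closure of [a * E] for any a in A, where E is its
   source, the filter of idempotents above some d(a); A is an ultrafilter iff
   every idempotent lies in E or is disjoint from a member of E.

   The elements of B(S) are controlled by germs.  A filter E of idempotents of S
   has in B(S) the neighbourhoods n above some beta(e) \ (beta(x1) \/ ...), with
   e in E and xi outside E.  The elements b such that, at every E, some b n is 0
   or beta(s) n form a Boolean inverse subsemigroup containing S, hence are all
   of B(S) by universality; and no neighbourhood is 0, because the Wagner-Preston
   representation of S extends to B(S).  If E is tight, every element of the
   Cuntz-Krieger ideal vanishes on some neighbourhood of E, so two elements of
   B(S) with the same image in T(S) have the same germ at E.

   The homeomorphism sends an ultrafilter A of T(S) to its preimage in S, and a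
   tight filter F to the upward closure of the q(beta(a) n), with a in F and n a
   neighbourhood of the source of F. *)

From Stdlib Require Import ssreflect List Classical FunctionalExtensionality
  PropExtensionality ProofIrrelevance.
Require Import Defs.
Import ListNotations.

Declare Scope isg_scope.
Local Open Scope isg_scope.
Notation "x * y" := (smul x y) : isg_scope.
Notation "x ^-1" := (sinv x) (at level 3, left associativity) : isg_scope.
Notation "0" := szero : isg_scope.
Notation "x <= y" := (leq x y) : isg_scope.

(** * Inverse semigroups *)

Section InverseSemigroup.
Context {S : ISG}.
Implicit Types x y z e f a b c : S.

Lemma premul2 {z x y k} : x * y = k -> z * x * y = z * k.
Proof. by move=> <-; rewrite smulA. Qed.

Lemma premul3 {z x y a k} : x * y * a = k -> z * x * y * a = z * k.
Proof. by move=> <-; rewrite !smulA. Qed.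

Lemma premul4 {z x y a b k} : x * y * a * b = k -> z * x * y * a * b = z * k.
Proof. by move=> <-; rewrite !smulA. Qed.

End InverseSemigroup.

(* Products are kept associated to the left, with [dom] and [ran] unfolded;
   [srw H] rewrites a factor of such a product by the closed equation [H]. *)
Ltac srw H :=
  let h := fresh in
  have h := H; rewrite ?/dom ?/ran ?smulA in h; rewrite ?/dom ?/ran ?smulA;
  first [rewrite h | rewrite (premul2 h) | rewrite (premul3 h) | rewrite (premul4 h)];
  rewrite ?smulA; clear h.

Section InverseSemigroupTheory.
Context {S : ISG}.
Implicit Types x y z e f a b c : S.

Lemma mulA x y z : x * (y * z) = x * y * z.
Proof. exact: smulA. Qed.

Lemma sinvK x : x^-1^-1 = x.
Proof. symmetry; apply: sinv_uniq; [exact: sinv_r | exact: sinv_l]. Qed.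

Lemma idem_sinv e : idem e -> e^-1 = e.
Proof. by move=> He; symmetry; apply: sinv_uniq; rewrite He. Qed.

(** With [x] the inverse of [e * f], the product [f * x * e] is an inverse of it too. Uniqueness
    gives [f * x * e = x], which makes [x] idempotent and so equal to its own inverse [e * f]. *)
Lemma idemM e f : idem e -> idem f -> idem (e * f).
Proof.
move=> He Hf; set x := (e * f)^-1.
have xl := sinv_l _ (e * f); have xr := sinv_r _ (e * f).
rewrite -/x ?smulA in xl xr.
have Hx : f * x * e = x.
{ apply: sinv_uniq; rewrite ?smulA.
  - by srw Hf; srw He.
  - by srw He; srw Hf; srw xr. }
have xx : idem x.
  by rewrite /idem -{1}Hx -{2}Hx; srw xr.
by rewrite -(sinvK (e * f)) -/x (idem_sinv _ xx).
Qed.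

(** The idempotent [e * f] is its own inverse, and [f * e] is an inverse of it. *)
Lemma idemC e f : idem e -> idem f -> e * f = f * e.
Proof.
move=> He Hf.
have Hef := idemM _ _ He Hf; have Hfe := idemM _ _ Hf He.
rewrite -(idem_sinv _ Hef); symmetry; apply: sinv_uniq; rewrite ?smulA.
- by srw Hf; srw He; rewrite -[RHS]Hef smulA.
- by srw He; srw Hf; rewrite -[RHS]Hfe smulA.
Qed.

Lemma idem0 : idem (0 : S).
Proof. exact: smul0l. Qed.

Lemma sinv0 : (0 : S)^-1 = 0.
Proof. exact: idem_sinv idem0. Qed.

Lemma idem_dom x : idem (dom x).
Proof. by rewrite /idem /dom smulA sinv_r. Qed.

Lemma idem_ran x : idem (ran x).
Proof. by rewrite /idem /ran smulA sinv_l. Qed.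

Lemma mul_dom x : x * dom x = x.
Proof. by rewrite /dom smulA sinv_l. Qed.

Lemma mul_ran x : ran x * x = x.
Proof. exact: sinv_l. Qed.

Lemma sinvM x y : (x * y)^-1 = y^-1 * x^-1.
Proof.
have H := idemC _ _ (idem_ran y) (idem_dom x).
rewrite /ran /dom ?smulA in H.
symmetry; apply: sinv_uniq; rewrite ?smulA.
- by srw H; rewrite sinv_l; srw (sinv_l _ y).
- by srw (Logic.eq_sym H); rewrite sinv_r; srw (sinv_r _ x).
Qed.

Lemma dom_idem e : idem e -> dom e = e.
Proof. by move=> He; rewrite /dom idem_sinv. Qed.

Lemma dom_eq0 x : dom x = 0 -> x = 0.
Proof. by move=> H; rewrite -(mul_dom x) H smul0r. Qed.

Lemma dom_mulr x e : idem e -> dom (x * e) = dom x * e.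
Proof.
move=> He; rewrite /dom sinvM (idem_sinv _ He) ?smulA.
have H := idemC _ _ He (idem_dom x); rewrite /dom smulA in H.
by rewrite H; srw He.
Qed.

Lemma idem_conj x e : idem e -> idem (x^-1 * e * x).
Proof.
move=> He; have -> : x^-1 * e * x = dom (e * x).
  by rewrite /dom sinvM (idem_sinv _ He) ?smulA; srw He.
exact: idem_dom.
Qed.

Lemma idem_mul_swap x e : idem e -> e * x = x * (x^-1 * e * x).
Proof.
move=> He; rewrite ?smulA.
have H := idemC _ _ (idem_ran x) He; rewrite /ran smulA in H.
by rewrite H; srw (sinv_l _ x).
Qed.

Lemma leq_mulr x e : idem e -> x * e <= x.
Proof.
move=> He; rewrite /leq dom_mulr // (idemC _ _ (idem_dom x) He) smulA.
by rewrite -smulA -(idemC _ _ (idem_dom x) He) smulA mul_dom.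
Qed.

Lemma leq_mull x e : idem e -> e * x <= x.
Proof. by move=> He; rewrite idem_mul_swap //; apply/leq_mulr/idem_conj. Qed.

Lemma leq_eq x y : x <= y -> x = y * dom x.
Proof. by []. Qed.

Lemma leq_refl x : x <= x.
Proof. by rewrite /leq mul_dom. Qed.

Lemma leq_dom x y : x <= y -> dom x = dom y * dom x.
Proof. by move=> H; rewrite {1}H dom_mulr //; exact: idem_dom. Qed.

Lemma leq_trans y x z : x <= y -> y <= z -> x <= z.
Proof.
move=> Hx Hy; rewrite Hx Hy -smulA; apply: leq_mulr.
by apply: idemM; exact: idem_dom.
Qed.


Lemma leq_antisym x y : x <= y -> y <= x -> x = y.
Proof.
move=> Hx Hy.
have Dx := leq_dom _ _ Hx; have Dy := leq_dom _ _ Hy.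
have E : dom x = dom y by rewrite Dx (idemC _ _ (idem_dom y) (idem_dom x)).
by rewrite Hx E mul_dom.
Qed.

Lemma leq0 x : 0 <= x.
Proof. by rewrite -(smul0r _ x); apply: leq_mulr; exact: idem0. Qed.

Lemma leq_0 x : x <= 0 -> x = 0.
Proof. by move=> H; apply: leq_antisym => //; exact: leq0. Qed.

Lemma leq_lmul z x y : x <= y -> z * x <= z * y.
Proof. by move=> ->; rewrite smulA; apply/leq_mulr/idem_dom. Qed.

Lemma leq_rmul z x y : x <= y -> x * z <= y * z.
Proof.
move=> ->; rewrite -smulA (idem_mul_swap _ _ (idem_dom x)) smulA.
by apply/leq_mulr/idem_conj/idem_dom.
Qed.

Lemma leq_mul x x' y y' : x <= x' -> y <= y' -> x * y <= x' * y'.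
Proof.
by move=> Hx Hy; apply: leq_trans (leq_rmul _ _ _ Hx) (leq_lmul _ _ _ Hy).
Qed.

Lemma leq_sinv x y : x <= y -> x^-1 <= y^-1.
Proof.
move=> ->; rewrite sinvM (idem_sinv _ (idem_dom _)).
by apply/leq_mull/idem_dom.
Qed.

Lemma leq_dommono x y : x <= y -> dom x <= dom y.
Proof. by move=> H; apply: leq_mul => //; exact: leq_sinv. Qed.

Lemma leq_idem x e : idem e -> x <= e -> idem x.
Proof. by move=> He ->; apply: idemM => //; exact: idem_dom. Qed.

Lemma idem_leqE e f : idem e -> e <= f -> f * e = e.
Proof. by move=> He; rewrite /leq dom_idem. Qed.

Lemma idem_leqP e f : idem e -> idem f -> e <= f <-> e * f = e.
Proof.
move=> He Hf; split=> [/(idem_leqE _ _ He)|H]; first by rewrite idemC.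
by rewrite /leq dom_idem // idemC.
Qed.

Lemma leq_meet x e f : idem e -> idem f -> x <= e -> x <= f -> x <= e * f.
Proof.
move=> He Hf Hxe Hxf; have Hx := leq_idem _ _ He Hxe.
by rewrite -Hx; exact: leq_mul.
Qed.

Lemma leq_dom_mul x y e : idem e -> x <= y -> dom x <= e -> x <= y * e.
Proof. by move=> He Hxy Hd; rewrite Hxy; exact: leq_lmul. Qed.

Lemma mulr_dom_le x e : idem e -> dom x <= e -> x * e = x.
Proof.
move=> He /idem_leqP H; rewrite -{1}(mul_dom x) -smulA H ?mul_dom //.
exact: idem_dom.
Qed.

Lemma compatible_below a x y : x <= a -> y <= a -> compatible x y.
Proof.
move=> Hx Hy; split.
- apply: (leq_idem _ (dom a)); first exact: idem_dom.
  by apply: leq_mul => //; exact: leq_sinv.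
- apply: (leq_idem _ (ran a)); first exact: idem_ran.
  by apply: leq_mul => //; exact: leq_sinv.
Qed.

Lemma compat_list_below a (X : list S) :
  (forall x, In x X -> x <= a) -> compat_list X.
Proof. by move=> H x y /H Hx /H Hy; exact: compatible_below Hx Hy. Qed.

(** Compatibility makes [x * y^-1] idempotent, so [x = x * y^-1 * y] lies below [y]. *)
Lemma compatible_dom_eq x y : compatible x y -> dom x = dom y -> x = y.
Proof.
move=> [_ H] E.
have L : x <= y by rewrite -(mul_dom x) E /dom smulA; exact: leq_mull.
by rewrite L E mul_dom.
Qed.

Lemma is_join_unique (X : list S) a b : is_join X a -> is_join X b -> a = b.
Proof. by move=> [Ha La] [Hb Lb]; apply: leq_antisym; auto. Qed.

Lemma is_join_le (X : list S) a x : is_join X a -> In x X -> x <= a.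
Proof. by case=> H _; apply: H. Qed.

Lemma join_nil a : is_join [] a -> a = 0.
Proof. by case=> _ H; apply: leq_0; apply: H. Qed.

Lemma is_join_all0 (X : list S) a : (forall x, In x X -> x = 0) -> is_join X a -> a = 0.
Proof. by move=> X0 [_ H]; apply: leq_0; apply: H => x /X0 ->; exact: leq0. Qed.

Lemma is_join_two x y a : x <= a -> y <= a ->
  (forall b, x <= b -> y <= b -> a <= b) -> is_join [x; y] a.
Proof.
move=> Hx Hy H; split; first by move=> z [<-|[<-|[]]].
by move=> b Hb; apply: H; apply: Hb; [left|right; left].
Qed.

End InverseSemigroupTheory.

#[local] Obligation Tactic := idtac.

(** * Homomorphisms of inverse semigroups *)

Section Homomorphisms.
Context {S T : ISG} (h : S -> T) (hh : hom h).

Lemma hom_mul x y : h (x * y) = h x * h y.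
Proof. exact: (proj1 hh). Qed.

Lemma hom_zero : h 0 = 0.
Proof. exact: (proj2 hh). Qed.

Lemma hom_sinv x : h x^-1 = (h x)^-1.
Proof. by apply: sinv_uniq; rewrite -!hom_mul ?sinv_l ?sinv_r. Qed.

Lemma hom_dom x : h (dom x) = dom (h x).
Proof. by rewrite hom_mul hom_sinv. Qed.

Lemma hom_idem e : idem e -> idem (h e).
Proof. by move=> He; rewrite /idem -hom_mul He. Qed.

Lemma hom_leq x y : x <= y -> h x <= h y.
Proof. by move=> Hxy; rewrite /leq -hom_dom -hom_mul -Hxy. Qed.

Lemma hom_compatible x y : compatible x y -> compatible (h x) (h y).
Proof. by move=> [H1 H2]; split; rewrite -hom_sinv -hom_mul; exact: hom_idem. Qed.

Lemma hom_idem_lift : (forall t, exists s, h s = t) ->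
  forall e, idem e -> exists f, idem f /\ h f = e.
Proof.
move=> sur e He; have [b Hb] := sur e; exists (dom b); split; first exact: idem_dom.
by rewrite hom_dom Hb dom_idem.
Qed.

End Homomorphisms.

(** * Joins in Boolean inverse semigroups *)

Section BooleanJoins.
Context {B : ISG} (BB : Boolean B).

Lemma join_exists (X : list B) : compat_list X -> exists a, is_join X a.
Proof. exact: (proj1 BB). Qed.

Lemma join_lmul s (X : list B) a :
  compat_list X -> is_join X a -> is_join (map (fun x => s * x) X) (s * a).
Proof. by move=> HX Ha; case: (proj1 (proj2 BB) X a s HX Ha). Qed.

Lemma join_rmul s (X : list B) a :
  compat_list X -> is_join X a -> is_join (map (fun x => x * s) X) (a * s).
Proof. by move=> HX Ha; case: (proj1 (proj2 BB) X a s HX Ha). Qed.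

Lemma is_join_compat (X : list B) a : is_join X a -> compat_list X.
Proof. by case=> H _; exact: compat_list_below H. Qed.

(** Finite joins reduce to binary ones: the tail of a list bounded by [a] has a join of its own. *)
Lemma join_closed (K : B -> Prop) :
  K 0 -> (forall x y z, K x -> K y -> is_join [x; y] z -> K z) ->
  forall X a, (forall x, In x X -> K x) -> is_join X a -> K a.
Proof.
move=> K0 K2; elim=> [|x X IH] a HX Ha; first by rewrite (join_nil _ Ha).
have [c Hc] : exists c, is_join X c.
  apply: join_exists; apply: (compat_list_below a) => y Hy.
  by apply: is_join_le Ha _; right.
apply: (K2 x c) => //; first by apply: HX; left.
  by apply: IH Hc => y Hy; apply: HX; right.
apply: is_join_two; first by apply: is_join_le Ha _; left.
  by apply: (proj2 Hc) => y Hy; apply: is_join_le Ha _; right.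
move=> b Hx Hb; apply: (proj2 Ha) => y [<- //|Hy].
by apply: leq_trans Hb; exact: is_join_le Hc Hy.
Qed.

Lemma join_sinv (X : list B) a : is_join X a -> is_join (map sinv X) a^-1.
Proof.
move=> [Ha La]; split.
  by move=> y /in_map_iff [x [<- Hx]]; apply/leq_sinv/Ha.
move=> b Hb; rewrite -(sinvK b); apply/leq_sinv/La => x Hx.
by rewrite -(sinvK x); apply/leq_sinv/Hb/in_map_iff; exists x.
Qed.

Lemma join_eq_of_le (X Y : list B) a : is_join X a -> (forall y, In y Y -> y <= a) ->
  (forall x, In x X -> exists2 y, In y Y & x <= y) -> is_join Y a.
Proof.
move=> [Ha La] HY HX; split=> // b Hb; apply: La => x /HX [y Hy Hxy].
exact: leq_trans Hxy (Hb _ Hy).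
Qed.

Lemma rel_diff_exists (a c : B) : c <= a -> exists x, rel_diff a c x.
Proof.
move=> Hca.
have [g [Hg [Hcg Hj]]] := proj2 (proj2 BB) _ _ (idem_dom c) (idem_dom a)
  (leq_dommono _ _ Hca).
have Hgc : g * dom c = 0 by rewrite -idemC //; exact: idem_dom.
(* [g] complements [dom c] in [dom a], so the difference is the restriction of [a] to [g]. *)
exists (a * g); split=> //; split; first exact: leq_mulr.
have Hc' := leq_eq _ _ Hca.
split; first split.
- have -> : (a * g)^-1 * c = g * (dom a * dom c).
    by rewrite sinvM (idem_sinv _ Hg) {1}Hc' {2}/dom !smulA.
  by rewrite -(leq_dom _ _ Hca).
- by rewrite {1}Hc' sinvM (idem_sinv _ (idem_dom _)) ?smulA; srw Hgc; rewrite smul0r smul0l.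
- have := join_lmul a _ _ (is_join_compat _ _ Hj) Hj; rewrite mul_dom /= -Hc'.
  by move=> H; apply: join_eq_of_le H _ _ => y /=; case=> [<-|[<-|[]]];
    [exact: leq_mulr | exact: Hca | exists c; auto; exact: leq_refl | exists (a * g); auto; exact: leq_refl].
Qed.

End BooleanJoins.

(** * The symmetric inverse monoid and the Wagner-Preston representation *)

Section SymmetricInverseMonoid.
Context (X : Type).

Record pbij := PBij {
  pb :> X -> X -> Prop;
  pb_fun : forall x y z, pb x y -> pb x z -> y = z;
  pb_inj : forall x y z, pb x z -> pb y z -> x = y }.

Lemma pbij_ext (R Q : pbij) : (forall x y, R x y <-> Q x y) -> R = Q.
Proof.
case: R Q => [R fR iR] [Q fQ iQ] /= H.
have E : R = Q.
  by apply: functional_extensionality => x; apply: functional_extensionality => y;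
     apply: propositional_extensionality.
by subst Q; rewrite (proof_irrelevance _ fR fQ) (proof_irrelevance _ iR iQ).
Qed.

(** The right factor acts first, so that [dom R] is the identity on the points where [R] is
    defined. *)
Program Definition pb_mul (R Q : pbij) : pbij :=
  {| pb := fun x z => exists y, Q x y /\ R y z |}.
Next Obligation.
by move=> R Q x y z [u [Hu Hy]] [v [Hv Hz]]; move: Hz; rewrite (pb_fun _ _ _ _ Hv Hu); apply: pb_fun.
Qed.
Next Obligation.
by move=> R Q x y z [u [Hu Hy]] [v [Hv Hz]]; move: Hv; rewrite (pb_inj _ _ _ _ Hz Hy); apply: pb_inj.
Qed.

Program Definition pb_inv (R : pbij) : pbij := {| pb := fun x y => R y x |}.
Next Obligation. by move=> R x y z; exact: pb_inj. Qed.
Next Obligation. by move=> R x y z; exact: pb_fun. Qed.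

Program Definition pb_zero : pbij := {| pb := fun _ _ => False |}.
Next Obligation. by []. Qed.
Next Obligation. by []. Qed.

Program Definition sim : ISG :=
  {| car := pbij; smul := pb_mul; szero := pb_zero; sinv := pb_inv |}.
Next Obligation. by move=> P Q R; apply: pbij_ext => x y /=; firstorder. Qed.
Next Obligation. by move=> R; apply: pbij_ext => x y /=; firstorder. Qed.
Next Obligation. by move=> R; apply: pbij_ext => x y /=; firstorder. Qed.
Next Obligation.
move=> R; apply: pbij_ext => x y /=; split; last by firstorder.
by move=> [u [H1 [v [H2 H3]]]]; rewrite (pb_inj _ _ _ _ H1 H2).
Qed.
Next Obligation.
move=> R; apply: pbij_ext => x y /=; split; last by firstorder.
by move=> [u [H1 [v [H2 H3]]]]; rewrite (pb_fun _ _ _ _ H1 H2).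
Qed.
Next Obligation.
move=> R Q /= H1 H2; apply: pbij_ext => x y /=; split=> H.
- move: (H); rewrite -{1}H2 /= => -[u [Hu [v [Hv Hy]]]].
  by rewrite -(pb_fun _ _ _ _ Hu H) -(pb_inj _ _ _ _ Hy H).
- move: (H); rewrite -{1}H1 /= => -[u [Hu [v [Hv Hy]]]].
  by rewrite -(pb_fun _ _ _ _ Hu H) -(pb_inj _ _ _ _ Hy H).
Qed.

Lemma sim_leq (R Q : sim) : R <= Q <-> forall x y, pb R x y -> pb Q x y.
Proof.
split=> [H x y Hxy|H].
  move: (Hxy); rewrite (leq_eq _ _ H) /= => -[u [[v [H1 H2]] H3]].
  by rewrite (pb_inj _ _ _ _ H1 H2).
apply: pbij_ext => x y /=; split; first by (move=> Hxy; exists x; split; [by exists y; split; exact: Hxy|exact: H]).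
move=> [u [[v [H1 H2]] H3]]; rewrite (pb_inj _ _ _ _ H2 H1) in H3.
by rewrite (pb_fun _ _ _ _ H3 (H _ _ H1)).
Qed.

Lemma sim_idem (R : sim) : idem R <-> forall x y, pb R x y -> x = y.
Proof.
split=> [H x y Hxy|H].
  move: (Hxy); rewrite -{1}H => -[u [H1 H2]].
  by rewrite (pb_fun _ _ _ _ H1 Hxy) in H2; exact: pb_inj Hxy H2.
apply: pbij_ext => x y; split=> /= [[u [H1 H2]]|Hxy].
  by rewrite (H _ _ H1).
by have E := H _ _ Hxy; subst y; exists x.
Qed.

Lemma sim_compat (R Q : sim) : compatible R Q ->
  (forall x y z, pb R x y -> pb Q x z -> y = z) /\
  (forall x y z, pb R x z -> pb Q y z -> x = y).
Proof.
move=> [/sim_idem H1 /sim_idem H2]; split=> x y z HR HQ.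
  by symmetry; apply: H2; exists x.
by symmetry; apply: H1; exists z.
Qed.

Lemma sim_union_join (L : list sim) (a : sim) :
  (forall x y, pb a x y <-> exists2 R, In R L & pb R x y) -> is_join L a.
Proof.
move=> H; split=> [R HR|Q HQ]; apply/sim_leq => x y.
  by move=> Hxy; apply/H; exists R.
by move=> /H [R HR]; apply: (proj1 (sim_leq _ _)); exact: HQ.
Qed.

Lemma sim_join_exists (L : list sim) : compat_list L ->
  exists a : sim, forall x y, pb a x y <-> exists2 R, In R L & pb R x y.
Proof.
move=> HL.
unshelve eexists (PBij (fun x y => exists2 R, In R L & pb R x y) _ _); last by [].
- move=> x y z [R HR HRx] [Q HQ HQx].
  by have [F _] := sim_compat _ _ (HL _ _ HR HQ); exact: F HRx HQx.
- move=> x y z [R HR HRx] [Q HQ HQx].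
  by have [_ F] := sim_compat _ _ (HL _ _ HR HQ); exact: F HRx HQx.
Qed.

Lemma sim_joinP (L : list sim) (a : sim) : compat_list L -> is_join L a ->
  forall x y, pb a x y <-> exists2 R, In R L & pb R x y.
Proof.
move=> HL Ha; have [a' Ha'] := sim_join_exists _ HL.
by rewrite (is_join_unique _ _ _ Ha (sim_union_join _ _ Ha')).
Qed.

Lemma sim_Boolean : Boolean sim.
Proof.
split; [|split].
- by move=> L /sim_join_exists [a Ha]; exists a; exact: sim_union_join.
- move=> L a s HL Ha; have H := sim_joinP _ _ HL Ha.
  split; apply: sim_union_join => x y /=; split.
  + move=> [u [/H [R HR H1] H2]]; exists (s * R); last by exists u.
    exact: (in_map (fun x => s * x)).
  + move=> [_ /in_map_iff [R [<- HR]] [u [H1 H2]]]; exists u; split=> //.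
    by apply/H; exists R.
  + move=> [u [H1 /H [R HR H2]]]; exists (R * s); last by exists u.
    exact: (in_map (fun x => x * s)).
  + move=> [_ /in_map_iff [R [<- HR]] [u [H1 H2]]]; exists u; split=> //.
    by apply/H; exists R.
- move=> e f He Hf /sim_leq Hef.
  have fE := proj1 (sim_idem f) Hf.
  unshelve eexists (PBij (fun x y => pb f x y /\ ~ pb e x y) _ _).
  { by move=> x y z [/fE <- _] [/fE <- _]. }
  { by move=> x y z [/fE -> _] [/fE -> _]. }
  split; first by apply/sim_idem => x y [/fE ->].
  split.
  + apply: pbij_ext => x y; split=> //= -[u [[/fE E H] H']].
    by subst u; case: H; have E := proj1 (sim_idem e) He _ _ H'; subst y.
  + apply: sim_union_join => x y /=; split.
    * move=> Hxy; case: (classic (pb e x y)) => He'; first by exists e; auto.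
      by eexists; [right; left; reflexivity|].
    * by move=> [R [<-|[<-|[]]]]; [exact: Hef|case].
Qed.

End SymmetricInverseMonoid.

Section WagnerPreston.
Context {S : ISG}.

(** The point [0] is dropped so that the element [0] goes to the empty relation. *)
Program Definition wagner_preston (s : S) : sim S :=
  @PBij S (fun x y => x <> 0 /\ dom s * x = x /\ y = s * x) _ _.
Next Obligation. by move=> s x y z [_ [_ ->]] [_ [_ ->]]. Qed.
Next Obligation.
move=> s x y z [_ [Hx Hz]] [_ [Hy Hz']].
by rewrite -Hx -Hy /dom -!smulA -Hz -Hz'.
Qed.

Lemma wagner_preston_hom : hom wagner_preston.
Proof.
split=> [s t|]; apply: pbij_ext => x y; last first.
  by split=> //= -[H [Hx _]]; apply: H; rewrite -Hx /dom smul0r smul0l.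
split=> /=.
- move=> [x0 [Hx ->]].
  have Ht : dom t * x = x.
    by rewrite -{1}Hx -[RHS]Hx /dom sinvM ?smulA; srw (sinv_r _ t).
  exists (t * x); split=> //; split; last split; last by rewrite smulA.
  + by move=> H; apply: x0; rewrite -Ht /dom -smulA H smul0r.
  + rewrite -{2}Hx /dom sinvM ?smulA.
    have H := idemC _ _ (idem_ran t) (idem_dom s); rewrite /ran /dom ?smulA in H.
    by srw H; srw (sinv_l _ t).
- move=> [z [[x0 [Ht ->]] [z0 [Hs ->]]]]; split=> //; split; last by rewrite smulA.
  by rewrite -[in RHS]Ht /dom sinvM -!smulA; rewrite -[in RHS]Hs /dom ?smulA.
Qed.

End WagnerPreston.

(** * Induction on a Booleanization *)

Section SubISG.
Context (B : ISG) (P : B -> Prop).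
Hypotheses (P0 : P 0) (PM : forall x y, P x -> P y -> P (x * y))
  (PV : forall x, P x -> P x^-1).

Lemma sig_eq (x y : {b | P b}) : proj1_sig x = proj1_sig y -> x = y.
Proof.
case: x y => [x Hx] [y Hy] /= E; subst y.
by rewrite (proof_irrelevance _ Hx Hy).
Qed.

Program Definition sub_isg : ISG := {|
  car := {b | P b};
  smul := fun x y => exist P (proj1_sig x * proj1_sig y) (PM _ _ (proj2_sig x) (proj2_sig y));
  szero := exist P 0 P0;
  sinv := fun x => exist P (proj1_sig x)^-1 (PV _ (proj2_sig x)) |}.
Next Obligation. by move=> x y z; apply: sig_eq; exact: smulA. Qed.
Next Obligation. by move=> x; apply: sig_eq; exact: smul0l. Qed.
Next Obligation. by move=> x; apply: sig_eq; exact: smul0r. Qed.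
Next Obligation. by move=> x; apply: sig_eq; exact: sinv_l. Qed.
Next Obligation. by move=> x; apply: sig_eq; exact: sinv_r. Qed.
Next Obligation.
move=> x y Hx Hy; apply: sig_eq; apply: sinv_uniq.
- exact: (f_equal (@proj1_sig _ _) Hx).
- exact: (f_equal (@proj1_sig _ _) Hy).
Qed.

Let val : sub_isg -> B := @proj1_sig B P.

Lemma sub_hom : hom val.
Proof. by []. Qed.

Lemma sub_idem (x : sub_isg) : idem x <-> idem (val x).
Proof. by split=> [|H]; [exact: hom_idem|apply: sig_eq]. Qed.

Lemma sub_leq (x y : sub_isg) : x <= y <-> val x <= val y.
Proof. by split=> [|H]; [exact: hom_leq|apply: sig_eq]. Qed.

Hypotheses (BB : Boolean B)
  (PJ : forall X a, (forall x, In x X -> P x) -> is_join X a -> P a)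
  (PD : forall e f g, idem e -> idem f -> idem g -> P e -> P f -> e * g = 0 ->
     is_join [e; g] f -> P g).

Lemma sub_compat (X : list sub_isg) : compat_list X -> compat_list (map val X).
Proof.
move=> HX _ _ /in_map_iff [x [<- Hx]] /in_map_iff [y [<- Hy]].
by apply: hom_compatible; [exact: sub_hom|exact: HX].
Qed.

Lemma sub_join_of (X : list sub_isg) a : is_join (map val X) (val a) -> is_join X a.
Proof.
move=> [Ha La]; split=> [x Hx|b Hb]; apply/sub_leq.
  by apply/Ha/in_map_iff; exists x.
by apply: La => _ /in_map_iff [x [<- Hx]]; apply/sub_leq/Hb.
Qed.

Lemma sub_join_exists (X : list sub_isg) : compat_list X ->
  exists a, is_join (map val X) (val a).
Proof.
move=> /sub_compat HX; have [a Ha] := join_exists BB _ HX.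
have Pa : P a by apply: PJ Ha => _ /in_map_iff [x [<- _]]; exact: (proj2_sig x).
by exists (exist P a Pa).
Qed.

Lemma sub_join (X : list sub_isg) a : compat_list X -> is_join X a ->
  is_join (map val X) (val a).
Proof.
move=> HX Ha; have [b Hb] := sub_join_exists _ HX.
by rewrite (is_join_unique _ _ _ Ha (sub_join_of _ _ Hb)).
Qed.

Lemma sub_Boolean : Boolean sub_isg.
Proof.
split; [|split].
- by move=> X /sub_join_exists [a Ha]; exists a; exact: sub_join_of.
- move=> X a s HX Ha; have Hj := sub_join _ _ HX Ha; have HX' := sub_compat _ HX.
  split; apply: sub_join_of.
  + by have := join_lmul BB (val s) _ _ HX' Hj; rewrite !map_map.
  + by have := join_rmul BB (val s) _ _ HX' Hj; rewrite !map_map.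
- move=> e f /sub_idem He /sub_idem Hf /sub_leq Hef.
  have [g [Hg [Heg Hj]]] := proj2 (proj2 BB) _ _ He Hf Hef.
  have Pg : P g by apply: PD Heg Hj => //; exact: proj2_sig.
  exists (exist P g Pg); split; first exact/sub_idem.
  by split; [exact: sig_eq|exact: sub_join_of].
Qed.

End SubISG.

Section BooleanizationInduction.
Context {S B : ISG} (beta : S -> B) (HB : is_booleanization S B beta).

(** The elements satisfying [P] form a Boolean inverse semigroup [C] through which [beta] factors.
    The universal map [phi] into [C], followed by the inclusion, is an additive endomorphism fixing
    the image of [S]; so is the identity, and uniqueness equates the two. *)
Lemma booleanization_ind (P : B -> Prop) :
  (forall s, P (beta s)) ->
  (forall x y, P x -> P y -> P (x * y)) -> (forall x, P x -> P x^-1) ->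
  (forall X a, (forall x, In x X -> P x) -> is_join X a -> P a) ->
  (forall e f g, idem e -> idem f -> idem g -> P e -> P f -> e * g = 0 ->
     is_join [e; g] f -> P g) ->
  forall b, P b.
Proof.
move=> Pb PM PV PJ PD b.
have [BB [bh [_ UB]]] := HB.
have P0 : P 0 by rewrite -(hom_zero _ bh).
pose C := sub_isg B P P0 PM PV; pose val : C -> B := @proj1_sig B P.
have CB : Boolean C by exact: sub_Boolean.
pose theta s : C := exist P (beta s) (Pb s).
have th : hom theta by split=> [x y|]; apply: sig_eq; [exact: hom_mul|exact: hom_zero].
have [phi [[ph pj] [phE _]]] := UB C CB theta th.
have [phi0 [_ [_ U]]] := UB B BB beta bh.
have E1 : b = phi0 b by apply: (U (fun b => b)).
suff -> : b = val (phi b) by exact: proj2_sig.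
rewrite {1}E1; symmetry; apply: (U (fun b => val (phi b))); last by move=> s; rewrite phE.
split; first by split=> [x y|]; rewrite ?(hom_mul _ ph) ?(hom_zero _ ph).
move=> x y z Hxy Hz.
(* The inclusion is additive because joins of compatible elements of [C] are also their joins in
   [B]. *)
apply: (sub_join _ _ P0 PM PV BB PJ [phi x; phi y]); last exact: pj.
apply: compat_list_below; exact: (proj1 (pj _ _ _ Hxy Hz)).
Qed.

End BooleanizationInduction.

(** * Filters of idempotents and germs *)

Record idem_filter {S : ISG} (E : S -> Prop) : Prop := {
  idf_idem : forall e, E e -> idem e;
  idf_ne : exists e, E e;
  idf_up : forall e f, E e -> idem f -> e <= f -> E f;
  idf_mul : forall e f, E e -> E f -> E (e * f);
  idf_0 : ~ E 0 }.

(** The transport of [E] along [s]: if [E] is the source of a germ of [s], this is its range. *)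
Definition conj_filter {S : ISG} (s : S) (E : S -> Prop) (f : S) : Prop :=
  idem f /\ E (s^-1 * f * s).

Lemma conj_idem_filter {S : ISG} (s : S) E :
  idem_filter E -> E (dom s) -> idem_filter (conj_filter s E).
Proof.
move=> HE Hs; split.
- by move=> e [].
- exists (ran s); split; first exact: idem_ran.
  by rewrite /ran mulA sinv_r.
- move=> e f [_ He] Hf Hef; split=> //; apply: (idf_up _ HE _ _ He).
    exact: idem_conj.
  by apply/leq_rmul/leq_lmul.
- move=> e f [He He'] [Hf Hf']; split; first exact: idemM.
  apply: (idf_up _ HE _ _ (idf_mul _ HE _ _ He' Hf')); first by apply/idem_conj/idemM.
  rewrite !mulA -(mulA _ s) -/(ran s).
  by apply: leq_rmul; apply: leq_rmul; apply: leq_mulr; exact: idem_ran.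
- by move=> [_]; rewrite smul0r smul0l; exact: idf_0.
Qed.

(* [n] dominates some [beta e \ (beta x1 \/ ...)] with [e] in [E] and the [xi]
   outside [E]; the bound over all [m] avoids choosing the difference. *)
Definition nbhd {S B : ISG} (beta : S -> B) (E : S -> Prop) (n : B) : Prop :=
  idem n /\ exists e X, E e /\ (forall x, In x X -> idem x /\ ~ E x) /\
    forall m, idem m -> m <= beta e -> (forall x, In x X -> m * beta x = 0) -> m <= n.

(** The bound [n <= beta (dom s)] makes the second case total: [b * n] then has domain [n], so [b]
    either vanishes on [n] or is defined on all of it. *)
Definition germ {S B : ISG} (beta : S -> B) (E : S -> Prop) (b n : B) : Prop :=
  b * n = 0 \/ exists s, E (dom s) /\ n <= beta (dom s) /\ b * n = beta s * n.

Section Germs.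
Context {S B : ISG} (beta : S -> B) (HB : is_booleanization S B beta).

Let BB : Boolean B := proj1 HB.
Let bh : hom beta := proj1 (proj2 HB).

Lemma beta_idem e : idem e -> idem (beta e).
Proof. exact: hom_idem. Qed.

(** [m] is the difference of [k] and all the [beta x], obtained by subtracting them one at a
    time. *)
Lemma idem_diff_list (X : list S) (k : B) : (forall x, In x X -> idem x) -> idem k ->
  exists m, idem m /\ m <= k /\ (forall x, In x X -> m * beta x = 0) /\
    is_join (m :: map (fun x => k * beta x) X) k.
Proof.
elim: X k => [|x X IH] k HX Hk.
  exists k; split=> //; split; first exact: leq_refl.
  split=> //; split=> [y [<-|[]]|b Hb]; first exact: leq_refl.
  by apply: Hb; left.
have Hx : idem (beta x) by apply: beta_idem; apply: HX; left.
have Hkx := idemM _ _ Hk Hx.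
have [g [Hg [H0 Hj]]] := proj2 (proj2 BB) _ _ Hkx Hk (leq_mulr _ _ Hx).
have gk : g <= k by apply: is_join_le Hj _; right; left.
have [m [Hm [mg [mX Hj']]]] := IH g (fun y Hy => HX y (or_intror Hy)) Hg.
exists m; split=> //; split; first exact: leq_trans gk.
split.
- move=> y [<-|]; last exact: mX.
  rewrite -(idem_leqE _ _ Hm (leq_trans _ _ _ mg gk)) (idemC _ _ Hk Hm) -mulA.
  by rewrite -(idem_leqE _ _ Hm mg) (idemC _ _ Hg Hm) -mulA (idemC _ _ Hg Hkx) H0 smul0r.
- split.
  + move=> y [<-|[<-|/in_map_iff [z [<- Hz]]]]; first exact: leq_trans gk.
      exact: leq_mulr.
    by apply/leq_mulr/beta_idem/HX; right.
  + move=> b Hb; apply: (proj2 Hj) => y [<-|[<-|[]]]; first by apply: Hb; right; left.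
    apply: (proj2 Hj') => z [<-|/in_map_iff [w [<- Hw]]]; first by apply: Hb; left.
    apply: leq_trans (leq_rmul _ _ _ gk) _; apply: Hb; right; right.
    exact: (in_map (fun x => k * beta x)).
Qed.

Section Fixed.
Context (E : S -> Prop) (HE : idem_filter E).

Lemma nbhd_mul n n' : nbhd beta E n -> nbhd beta E n' -> nbhd beta E (n * n').
Proof.
move=> [Hn [e [X [He [HX H]]]]] [Hn' [e' [X' [He' [HX' H']]]]].
split; first exact: idemM.
exists (e * e'), (X ++ X'); split; first exact: idf_mul.
split=> [x /in_app_iff [/HX|/HX'] //|m Hm Hme HmX].
have Ie := idf_idem _ HE _ He; have Ie' := idf_idem _ HE _ He'.
apply: leq_meet => //.
- apply: H => //; last by move=> x Hx; apply: HmX; apply/in_app_iff; left.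
  by apply: leq_trans Hme _; apply: hom_leq => //; exact: leq_mulr.
- apply: H' => //; last by move=> x Hx; apply: HmX; apply/in_app_iff; right.
  by apply: leq_trans Hme _; apply: hom_leq => //; exact: leq_mull.
Qed.

Lemma nbhd_beta e : E e -> nbhd beta E (beta e).
Proof.
move=> He; split; first by apply/beta_idem/(idf_idem _ HE).
by exists e, []; split=> //; split.
Qed.

(** [n'] is [n] minus [beta x], with [x] added to the excluded idempotents. *)
Lemma nbhd_avoid n x : nbhd beta E n -> idem x -> ~ E x ->
  exists n', nbhd beta E n' /\ n' <= n /\ beta x * n' = 0.
Proof.
move=> [Hn [e [X [He [HX H]]]]] Hx Ex; have Hbx := beta_idem _ Hx.
have Hnx := idemM _ _ Hn Hbx.
have [g [Hg [H0 Hj]]] := proj2 (proj2 BB) _ _ Hnx Hn (leq_mulr _ _ Hbx).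
have gn : g <= n by apply: is_join_le Hj _; right; left.
exists g; split; last split=> //.
- split=> //; exists e, (x :: X); split=> //; split=> [y [<- //|/HX //]|m Hm Hme HmX].
  have mn : m <= n by apply: H => // y Hy; apply: HmX; right.
  (* [m = m * n] is the join of [m * (n * beta x)], which is [0], and [m * g]; hence [m <= g]. *)
  have := join_lmul BB m _ _ (is_join_compat _ _ Hj) Hj.
  rewrite (idemC _ _ Hm Hn) (idem_leqE _ _ Hm mn) /= => -[_]; apply.
  move=> _ [<-|[<-|[]]]; last exact: leq_mull.
  rewrite (idemC _ _ Hn Hbx) mulA (HmX x (or_introl Logic.eq_refl)) smul0l; exact: leq0.
- by rewrite -(idem_leqE _ _ Hg gn) mulA (idemC _ _ Hbx Hn).
Qed.

Lemma nbhd_all X (Q : B -> B -> Prop) :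
  (forall x n n', Q x n -> idem n' -> n' <= n -> Q x n') ->
  (forall x, In x X -> exists n, nbhd beta E n /\ Q x n) ->
  exists n, nbhd beta E n /\ forall x, In x X -> Q x n.
Proof.
move=> Qm; elim: X => [|x X IH] HX.
  by have [e He] := idf_ne _ HE; exists (beta e); split=> //; exact: nbhd_beta.
have [n [Hn Hx]] := HX x (or_introl Logic.eq_refl).
have [n' [Hn' HX']] := IH (fun y Hy => HX y (or_intror Hy)).
exists (n * n'); split; first exact: nbhd_mul.
have I := proj1 (nbhd_mul _ _ Hn Hn'); have [idn _] := Hn; have [In' _] := Hn'.
move=> y [<-|Hy]; first by apply: Qm Hx I _; exact: leq_mulr.
by apply: Qm (HX' _ Hy) I _; exact: leq_mull.
Qed.

(** The element [e] serves as a point of the Wagner-Preston representation. The image of [beta e]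
    fixes it and is built by unions from those of [m] and of the [beta e * beta x]. None of the
    latter fixes it, as [x] is outside [E], so [m] does. *)
Lemma nbhd_point (phi : B -> sim S) : additive_hom phi ->
  (forall s, phi (beta s) = wagner_preston s) ->
  forall n d, nbhd beta E n -> E d ->
  exists e m, E e /\ e <= d /\ idem m /\ m <= n /\ pb _ (phi m) e e.
Proof.
move=> [ph pj] pE n d [Hn [e0 [X [He0 [HX H]]]]] Hd.
have Ed := idf_idem _ HE _ Hd; have Ee0 := idf_idem _ HE _ He0.
have He := idf_mul _ HE _ _ He0 Hd; set e := e0 * d in He.
have Ie := idf_idem _ HE _ He.
have [m [Hm [me [mX Hj]]]] := idem_diff_list X (beta e) (fun x Hx => proj1 (HX x Hx))
  (beta_idem _ Ie).
exists e, m; split=> //; split; first exact: leq_mull.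
split=> //; split.
  apply: H => //; apply: leq_trans me _.
  by apply: hom_leq => //; exact: leq_mulr.
apply: NNPP => Hno.
have K : ~ pb _ (phi (beta e)) e e.
{ apply: (join_closed BB (fun b => ~ pb _ (phi b) e e)) Hj.
  - by rewrite hom_zero //.
  - move=> x y z Kx Ky Kz.
    have Hxy := is_join_compat _ _ Kz _ _ (or_introl Logic.eq_refl) (or_intror (or_introl Logic.eq_refl)).
    have Pz := pj _ _ _ Hxy Kz.
    by move=> /(sim_joinP _ _ _ (is_join_compat _ _ Pz) Pz) [R [<-|[<-|[]]]].
  - move=> b [<- //|/in_map_iff [x [<- Hx]]].
    (* If [e * x] fixed the point [e], then [e <= x], and upward closure would put [x] in [E]. *)
    rewrite -(hom_mul _ bh) pE => -[e0' [Hd1 _]]; have [Ix] := HX _ Hx; apply.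
    apply: (idf_up _ HE _ _ He Ix); apply/(idem_leqP _ _ Ie Ix).
    rewrite -[RHS]Hd1 (dom_idem _ (idemM _ _ Ie Ix)).
    by rewrite -mulA (idemC _ _ Ix Ie) mulA Ie. }
apply: K; rewrite pE; split; last by rewrite dom_idem // !Ie.
by move=> E0; apply: (idf_0 _ HE); rewrite -E0.
Qed.

(** Otherwise [nbhd_point] gives a point related to itself by the empty relation. *)
Lemma nbhd_neq0 : ~ nbhd beta E 0.
Proof.
move=> H; have [e He] := idf_ne _ HE.
have [_ [_ [_ UB]]] := HB.
have [phi [pa [pE _]]] := UB _ (sim_Boolean S) _ wagner_preston_hom.
have [e' [m [_ [_ [_ [/leq_0 -> ]]]]]] := nbhd_point _ pa pE _ _ H He.
by rewrite (hom_zero _ (proj1 pa)).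
Qed.

(** At the point [e] given by [nbhd_point], the two sides take the values [x * e] and [y * e]. *)
Lemma nbhd_eq n x y : nbhd beta E n -> E (dom x) -> beta x * n = beta y * n ->
  exists e, E e /\ x * e = y * e.
Proof.
move=> Hn Hx Hxy.
have [_ [_ [_ UB]]] := HB.
have [phi [pa [pE _]]] := UB _ (sim_Boolean S) _ wagner_preston_hom.
have [e [m [He [Hed [Hm [Hmn P]]]]]] := nbhd_point _ pa pE _ _ Hn Hx.
exists e; split=> //.
have Ie := idf_idem _ HE _ He.
have Exy : beta x * m = beta y * m.
  by rewrite -(idem_leqE _ _ Hm Hmn) !mulA Hxy.
have : pb _ (phi (beta x * m)) e (x * e).
  rewrite (hom_mul _ (proj1 pa)) pE /=; exists e; split=> //; split; last first.
    by split=> //; exact: idem_leqE.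
  by move=> E0; apply: (idf_0 _ HE); rewrite -E0.
rewrite Exy (hom_mul _ (proj1 pa)) pE /= => -[u [Pu [_ [_ ->]]]].
by rewrite (pb_fun _ _ _ _ _ P Pu).
Qed.

Lemma germ_mono b n n' : germ beta E b n -> idem n' -> n' <= n -> germ beta E b n'.
Proof.
move=> H Hn' Hle; rewrite /germ -(idem_leqE _ _ Hn' Hle) !mulA.
case: H => [->|[s [Hs [Hn ->]]]]; first by left; rewrite smul0l.
right; exists s; split=> //; split; last by rewrite mulA.
rewrite (idem_leqE _ _ Hn' Hle); exact: leq_trans Hn.
Qed.

Lemma germ_dom b n : idem n -> germ beta E b n -> b * n = 0 \/ dom (b * n) = n.
Proof.
move=> Hn [->|[s [_ [Hs ->]]]]; [by left|right].
rewrite dom_mulr // -(hom_dom _ bh); exact: idem_leqE.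
Qed.

Lemma germ_idem e n : idem e -> idem n -> germ beta E e n -> e * n = 0 \/ e * n = n.
Proof.
move=> He Hn /(germ_dom _ _ Hn) [->|]; first by left.
by rewrite (dom_idem _ (idemM _ _ He Hn)); right.
Qed.

End Fixed.

(** Conjugation by [s] carries an idempotent [m] below [s^-1 * f * s], disjoint from the conjugates
    of the excluded [x], to one below [f] and disjoint from the [x], hence below [M]. Conjugating
    back recovers [m]. *)
Lemma nbhd_conj E s M : idem_filter E -> E (dom s) -> nbhd beta (conj_filter s E) M ->
  nbhd beta E ((beta s)^-1 * M * beta s).
Proof.
move=> HE Hs [HM [f [X [[If Hf] [HX H]]]]]; split; first exact: idem_conj.
exists (s^-1 * f * s), (map (fun x => s^-1 * x * s) X); split=> //; split.
  move=> _ /in_map_iff [x [<- /HX [Hx Nx]]]; split; first exact: idem_conj.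
  by move=> Ex; apply: Nx.
move=> m Hm Hmf HmX.
have L : beta s * m * (beta s)^-1 <= M.
{ apply: H.
  - by have := idem_conj (beta s)^-1 m Hm; rewrite sinvK.
  - apply: leq_trans (leq_rmul _ _ _ (leq_lmul _ _ _ Hmf)) _.
    rewrite -(hom_sinv _ bh) -!(hom_mul _ bh); apply: hom_leq => //.
    rewrite !mulA -/(ran s) -(mulA _ s) -/(ran s).
    apply: leq_trans (leq_mulr _ _ (idem_ran s)) _.
    by apply/leq_mull/idem_ran.
  - move=> x Hx; have [Ix _] := HX _ Hx.
    have C : s^-1 * x = s^-1 * x * s * s^-1.
      have C := idemC _ _ Ix (idem_ran s); rewrite -!(mulA s^-1) -!(mulA x) -/(ran s) C.
      by rewrite /ran !mulA sinv_r.
    rewrite -(hom_sinv _ bh) -mulA -(hom_mul _ bh) C (hom_mul _ bh) !mulA -(mulA _ m) HmX ?smul0r ?smul0l //.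
    exact: (in_map (fun x => s^-1 * x * s)). }
have D : beta (dom s) * m = m.
  apply: idem_leqE => //; apply: leq_trans Hmf _; apply: hom_leq => //.
  rewrite /dom -mulA; apply/leq_lmul/leq_mull => //.
have -> : m = (beta s)^-1 * (beta s * m * (beta s)^-1) * beta s.
  rewrite -(hom_sinv _ bh) !mulA -(hom_mul _ bh) -/(dom s) D -mulA -(hom_mul _ bh) -/(dom s).
  by rewrite (idemC _ _ Hm) ?D //; apply/beta_idem/idem_dom.
by apply: leq_rmul; apply: leq_lmul.
Qed.

(** * Every element of the Booleanization has germs *)

Definition has_germs (b : B) : Prop :=
  forall E, idem_filter E -> exists n, nbhd beta E n /\ germ beta E b n.

Lemma has_germs_beta s : has_germs (beta s).
Proof.
move=> E HE; case: (classic (E (dom s))) => Hs.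
  exists (beta (dom s)); split; first exact: nbhd_beta.
  by right; exists s; split=> //; split=> //; exact: leq_refl.
have [e He] := idf_ne _ HE.
have [n [Hn [_ H0]]] := nbhd_avoid _ _ _ (nbhd_beta _ HE _ He) (idem_dom s) Hs.
exists n; split=> //; left.
by rewrite -(mul_dom s) (hom_mul _ bh) -mulA H0 smul0r.
Qed.

(** Germs compose: if [y] is [s] near [E] and [x] is [r] near the transported filter
    [conj_filter s E], then [x * y] is [r * s] on [n] cut down by the neighbourhood of [x] pulled
    back along [s]. *)
Lemma has_germs_mul x y : has_germs x -> has_germs y -> has_germs (x * y).
Proof.
move=> Rx Ry E HE; have [n [Hn [Y0|[s [Es [Ls Ys]]]]]] := Ry E HE.
  by exists n; split=> //; left; rewrite -mulA Y0 smul0r.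
have [M [HM GM]] := Rx _ (conj_idem_filter s E HE Es).
have HM' := nbhd_conj _ _ _ HE Es HM; set M' := _ * M * _ in HM'.
have idn := proj1 Hn; have IM := proj1 HM; have IM' := proj1 HM'.
exists (M' * n); split; first exact: nbhd_mul.
have Exy : x * y * (M' * n) = x * M * beta s * n.
  rewrite (idemC _ _ IM' idn) -(mulA x y) (mulA y) Ys -(mulA _ n) (idemC _ _ idn IM').
  by rewrite (mulA (beta s)) -idem_mul_swap // !mulA.
case: GM => [X0|[r [[_ Er] [Lr Xr]]]]; first by left; rewrite Exy X0 !smul0l.
right; exists (r * s).
have Ed : dom (r * s) = s^-1 * dom r * s by rewrite /dom sinvM !mulA.
rewrite Ed; split=> //; split.
  apply: leq_trans (leq_mulr _ _ idn) _.
  rewrite (hom_mul _ bh (_ * _) s) (hom_mul _ bh s^-1) (hom_sinv _ bh).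
  by apply: leq_rmul; apply: leq_lmul.
by rewrite Exy Xr -(mulA (beta r)) (idem_mul_swap _ _ IM) (hom_mul _ bh) !mulA.
Qed.

(** On a common neighbourhood [n], each term vanishes or has domain [n]. The non-vanishing ones are
    compatible with equal domains, hence equal, and the join is their common value. *)
Lemma has_germs_join X a : (forall x, In x X -> has_germs x) -> is_join X a -> has_germs a.
Proof.
move=> HX Ha E HE.
have [n [Hn G]] : exists n, nbhd beta E n /\ forall x, In x X -> germ beta E x n.
  by apply: nbhd_all => // [x n n'|x /HX]; [exact: germ_mono|apply].
have idn := proj1 Hn.
exists n; split=> //.
have Hj := join_rmul BB n _ _ (is_join_compat _ _ Ha) Ha.
case: (classic (exists x, In x X /\ x * n <> 0)) => [[x [Hx Nx]]|N]; last first.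
  left; apply: is_join_all0 Hj => _ /in_map_iff [x [<- Hx]].
  by apply: NNPP => H; apply: N; exists x.
have D : forall y, In y X -> y * n <> 0 -> dom (y * n) = n.
  by move=> y /G /(germ_dom _ _ _ idn) [].
rewrite /germ; suff -> : a * n = x * n by exact: G.
apply: leq_antisym; last by apply: is_join_le Hj _; exact: (in_map (fun x => x * n)).
apply: (proj2 Hj) => _ /in_map_iff [y [<- Hy]].
case: (classic (y * n = 0)) => [->|Ny]; first exact: leq0.
have -> : y * n = x * n; last exact: leq_refl.
apply: compatible_dom_eq; last by rewrite !D.
by apply: (is_join_compat _ _ Hj); exact: (in_map (fun x => x * n)).
Qed.

(** Near [E] either [e] vanishes and [g] agrees with [f], or [e] is everything and [g] vanishes. *)
Lemma has_germs_diff e f g : idem e -> idem f -> idem g -> has_germs e -> has_germs f ->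
  e * g = 0 -> is_join [e; g] f -> has_germs g.
Proof.
move=> Ie If Ig Re Rf H0 Hj E HE.
have [n [Hn Ge]] := Re E HE; have [n' [Hn' Gf]] := Rf E HE.
have N := nbhd_mul _ HE _ _ Hn Hn'.
have I := proj1 Hn; have I' := proj1 Hn'; have idn := proj1 N.
exists (n * n'); split=> //.
have [e0|en] := germ_idem _ _ _ Ie idn (germ_mono _ _ _ _ Ge idn (leq_mulr _ _ I')).
- have := join_rmul BB (n * n') _ _ (is_join_compat _ _ Hj) Hj => /= Hj'.
  have G := germ_mono _ _ _ _ Gf idn (leq_mull _ _ I).
  rewrite /germ; suff <- : f * (n * n') = g * (n * n') by [].
  apply: leq_antisym; last by apply: is_join_le Hj' _; right; left.
  apply: (proj2 Hj') => _ [<-|[<-|[]]]; rewrite ?e0; [exact: leq0|exact: leq_refl].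
- by left; rewrite -en mulA (idemC _ _ Ig Ie) H0 smul0l.
Qed.

Theorem booleanization_germs b : has_germs b.
Proof.
(* A germ describes [b] from its source side only, so closure under inverses is obtained by carrying
   both statements. *)
suff H : forall b, has_germs b /\ has_germs b^-1 by case: (H b).
apply: (booleanization_ind beta HB).
- by move=> s; rewrite -(hom_sinv _ bh); split; exact: has_germs_beta.
- by move=> x y [Rx Rx'] [Ry Ry']; rewrite sinvM; split; exact: has_germs_mul.
- by move=> x [R R']; rewrite sinvK.
- move=> X a HX Ha; split; first by apply: has_germs_join Ha => x /HX [].
  by apply: has_germs_join (join_sinv _ _ Ha) => _ /in_map_iff [x [<- /HX []]].
- move=> e f g Ie If Ig [Re _] [Rf _] H0 Hj; rewrite (idem_sinv _ Ig).
  by have := has_germs_diff _ _ _ Ie If Ig Re Rf H0 Hj.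
Qed.

Lemma idem_germ E h : idem_filter E -> idem h ->
  exists n, nbhd beta E n /\ (h * n = 0 \/ h * n = n).
Proof.
move=> HE Ih; have [n [Hn G]] := booleanization_germs h E HE; exists n; split=> //.
exact: germ_idem (proj1 Hn) G.
Qed.

(** A way to say that [dom b] lies below a finite join of idempotents of [S]; it makes [beta_source]
    non-empty. *)
Definition bounded (b : B) : Prop := exists L : list S,
  (forall e, In e L -> idem e) /\ is_join (map (fun e => b * beta e) L) b.

Lemma bounded_mul x y : bounded y -> bounded (x * y).
Proof.
move=> [L [IL HL]]; exists L; split=> //.
have := join_lmul BB x _ _ (is_join_compat _ _ HL) HL; rewrite map_map.
by under map_ext => e do rewrite mulA.
Qed.

Lemma bounded_join X a : (forall x, In x X -> bounded x) -> is_join X a -> bounded a.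
Proof.
move=> HX Ha.
have [L [IL HL]] : exists L : list S, (forall e, In e L -> idem e) /\
   forall x, In x X -> is_join (map (fun e => x * beta e) L) x.
{ elim: X HX {Ha} => [|x X IH] HX; first by exists [].
  have [L [IL HL]] := HX x (or_introl Logic.eq_refl).
  have [L' [IL' HL']] := IH (fun y Hy => HX y (or_intror Hy)).
  exists (L ++ L'); split=> [e /in_app_iff [/IL|/IL'] //|y Hy].
  have I : forall e, In e (L ++ L') -> y * beta e <= y.
    by move=> e /in_app_iff [/IL|/IL'] Ie; apply/leq_mulr/beta_idem.
  have I' : forall z, In z (map (fun e => y * beta e) (L ++ L')) -> z <= y.
    by move=> z /in_map_iff [e [<- /I]].
  case: Hy => [Ey|/HL' Hy].
  - subst y; apply: join_eq_of_le HL I' _ => z Hz.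
    by exists z; [rewrite map_app; apply/in_app_iff; left|exact: leq_refl].
  - apply: join_eq_of_le Hy I' _ => z Hz.
    by exists z; [rewrite map_app; apply/in_app_iff; right|exact: leq_refl]. }
exists L; split=> //; split.
  by move=> z /in_map_iff [e [<- /IL Ie]]; apply/leq_mulr/beta_idem.
move=> b Hb; apply: (proj2 Ha) => x Hx; apply: (proj2 (HL _ Hx)) => z /in_map_iff [e [<- He]].
apply: leq_trans (leq_rmul _ _ _ (is_join_le _ _ _ Ha Hx)) _.
by apply: Hb; exact: (in_map (fun e => a * beta e)).
Qed.

Theorem booleanization_bounded b : bounded b.
Proof.
suff H : forall b, bounded b /\ bounded b^-1 by case: (H b).
have Hb : forall s, bounded (beta s).
  move=> s; exists [dom s]; split; first by move=> _ [<-|[]]; exact: idem_dom.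
  rewrite /= -(hom_mul _ bh) mul_dom; split=> [_ [<-|[]]|c]; first exact: leq_refl.
  by apply; left.
apply: (booleanization_ind beta HB).
- by move=> s; rewrite -hom_sinv.
- by move=> x y [Rx Rx'] [Ry Ry']; rewrite sinvM; split; exact: bounded_mul.
- by move=> x [R R']; rewrite sinvK.
- move=> X a HX Ha; split; first by apply: bounded_join Ha => x /HX [].
  by apply: bounded_join (join_sinv _ _ Ha) => _ /in_map_iff [x [<- /HX []]].
- move=> e f g Ie If Ig _ [Rf _] _ Hj; rewrite (idem_sinv _ Ig).
  have fg : f * g = g by apply: idem_leqE => //; apply: is_join_le Hj _; right; left.
  have := bounded_mul g f Rf; rewrite (idemC _ _ Ig If) fg //.
Qed.

End Germs.

(** * Filters and their sources *)

Definition source {S : ISG} (F : S -> Prop) (e : S) : Prop :=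
  idem e /\ exists a, F a /\ dom a <= e.

Lemma same_eq {S : ISG} (A A' : S -> Prop) : same A A' -> A = A'.
Proof.
by move=> H; apply: functional_extensionality => x; exact: propositional_extensionality.
Qed.

Section Filters.
Context {S : ISG}.
Implicit Types (F A B : S -> Prop).

Lemma filter_up F x y : proper_filter F -> F x -> x <= y -> F y.
Proof. by move=> [_ [H _]]; exact: H. Qed.

Lemma filter_meet F x y : proper_filter F -> F x -> F y ->
  exists z, F z /\ z <= x /\ z <= y.
Proof. by move=> [_ [_ [H _]]]; exact: H. Qed.

Lemma filter_neq0 F : proper_filter F -> ~ F 0.
Proof. by move=> [_ [_ [_ H]]]. Qed.

Lemma ultra_proper F : ultrafilter F -> proper_filter F.
Proof. by case. Qed.

(** A lower bound of [a] and of an element with domain below [e] lies below [a * e], so the source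
    can be tested on any one [a] in [F]. *)
Lemma source_mulP F a e : proper_filter F -> F a -> idem e -> source F e <-> F (a * e).
Proof.
move=> PF Fa He; split=> [[_ [b [Fb Hb]]]|Fae].
  have [w [Fw [wa wb]]] := filter_meet _ _ _ PF Fa Fb.
  apply: filter_up PF Fw _; apply: leq_dom_mul => //.
  by apply: leq_trans Hb; exact: leq_dommono.
split=> //; exists (a * e); split=> //; rewrite dom_mulr //.
by apply/leq_mull/idem_dom.
Qed.

Lemma source_filter F : proper_filter F -> idem_filter (source F).
Proof.
move=> PF; have [[a Fa] _] := PF; split.
- by move=> e [].
- exists (dom a); split; first exact: idem_dom.
  by exists a; split=> //; exact: leq_refl.
- move=> e f [_ [b [Fb Hb]]] Hf Hef; split=> //; exists b; split=> //.
  exact: leq_trans Hef.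
- move=> e f Ee Ef; have [He _] := Ee; have [Hf _] := Ef.
  apply/(source_mulP _ _ _ PF Fa); first exact: idemM.
  rewrite mulA; apply/(source_mulP _ _ _ PF _ Hf) => //.
  by apply/source_mulP.
- move=> [_ [b [Fb /leq_0 /dom_eq0 Hb]]].
  by subst b; exact: (filter_neq0 _ PF).
Qed.

(* A filter is the upward closure of [a * source F] for any [a] in it, so
   maximality of [F] amounts to maximality of the idempotent filter [source F]. *)
Lemma ultrafilterP F : proper_filter F ->
  ultrafilter F <->
  forall e, idem e -> source F e \/ exists f, source F f /\ e * f = 0.
Proof.
move=> PF; have [[a Fa] _] := PF; have IF := source_filter _ PF.
split=> [[_ U] e He|H].
- case: (classic (exists f, source F f /\ e * f = 0)) => N; [by right|left].
  (* [G] is the filter generated by [F] and [a * e]; it is proper because [e] is disjoint from no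
     member of the source. *)
  pose G x := exists f, source F f /\ a * (e * f) <= x.
  have Ge : G (a * e).
    exists (dom a); split; last by apply/leq_lmul/leq_mulr/idem_dom.
    split; first exact: idem_dom.
    by exists a; split=> //; exact: leq_refl.
  apply/(source_mulP _ _ _ PF Fa He); apply: U (Ge); last first.
    move=> x Fx; have [z [Fz [zx za]]] := filter_meet _ _ _ PF Fx Fa.
    exists (dom z); split.
      split; first exact: idem_dom.
      by exists z; split=> //; exact: leq_refl.
    apply: leq_trans zx; rewrite [X in _ <= X](leq_eq _ _ za).
    by apply/leq_lmul/leq_mull.
  split; first by exists (a * e).
  split; first by move=> x y [f [Ef Hx]] Hxy; exists f; split=> //; exact: leq_trans Hxy.
  split.
    move=> x y [f [Ef Hf]] [g [Eg Hg]]; exists (a * (e * (f * g))); split.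
      by exists (f * g); split; [exact: idf_mul|exact: leq_refl].
    have [If _] := Ef; have [Ig _] := Eg.
    split; [apply: leq_trans Hf|apply: leq_trans Hg]; apply: leq_lmul; apply: leq_lmul.
      exact: leq_mulr.
    exact: leq_mull.
  move=> [f [Ef /leq_0 H0]]; apply: N; have [If _] := Ef.
  exists (f * dom a); split.
    apply: idf_mul => //; split; first exact: idem_dom.
    by exists a; split=> //; exact: leq_refl.
  have Ief := idemM _ _ He If.
  by rewrite mulA (idemC _ _ Ief (idem_dom a)) /dom -mulA H0 smul0r.
- split=> // G PG FG x Gx.
  have [z [Gz [za zx]]] := filter_meet _ _ _ PG (FG _ Fa) Gx.
  case: (H (dom z) (idem_dom z)) => [/(source_mulP _ _ _ PF Fa (idem_dom z))|].
    by rewrite -(leq_eq _ _ za) => Fz; exact: filter_up PF Fz zx.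
  (* A lower bound in [G] of [z] and [a * f] has domain below [dom z * f = 0], contradicting
     properness. *)
  move=> [f [Ef H0]]; have [If _] := Ef.
  have Gf : G (a * f) by apply: FG; apply/source_mulP.
  have [w [Gw [wz wf]]] := filter_meet _ _ _ PG Gz Gf.
  case: (filter_neq0 _ PG); suff <- : w = 0 by [].
  apply: dom_eq0; apply: leq_0; rewrite -H0; apply: leq_meet => //; first exact: idem_dom.
    exact: leq_dommono.
  apply: leq_trans (leq_dommono _ _ wf) _; rewrite dom_mulr //.
  by apply/leq_mull/idem_dom.
Qed.

Lemma finvK F : finv (finv F) = F.
Proof. by apply: same_eq => x; rewrite /finv sinvK. Qed.

Lemma finv_proper F : proper_filter F -> proper_filter (finv F).
Proof.
move=> PF; have [[a Fa] _] := PF; split; first by exists a^-1; rewrite /finv sinvK.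
split; first by move=> x y Fx /leq_sinv; exact: filter_up.
split; last by rewrite /finv sinv0; exact: filter_neq0.
move=> x y Fx Fy; have [z [Fz [zx zy]]] := filter_meet _ _ _ PF Fx Fy.
exists z^-1; rewrite /finv sinvK; split=> //.
by rewrite -(sinvK x) -(sinvK y); split; exact: leq_sinv.
Qed.

Lemma finv_ultra F : ultrafilter F -> ultrafilter (finv F).
Proof.
move=> [PF U]; split; first exact: finv_proper.
move=> G PG FG x Gx; apply: (U _ (finv_proper _ PG)); last by rewrite /finv sinvK.
by move=> y Fy; apply: FG; rewrite /finv sinvK.
Qed.

Lemma fprod_finvP A x : proper_filter A ->
  fprod (finv A) A x <-> exists e, source A e /\ e <= x.
Proof.
move=> PA; split=> [[a [b [Aa [Ab Hx]]]]|[e [[_ [a [Aa Ha]]] Hx]]].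
  have [w [Aw [wa wb]]] := filter_meet _ _ _ PA Aa Ab.
  exists (dom w); split.
    by split; [exact: idem_dom|exists w; split=> //; exact: leq_refl].
  apply: leq_trans Hx; apply: leq_mul => //.
  by rewrite -(sinvK a); exact: leq_sinv.
exists a^-1, a; rewrite /finv sinvK; split=> //; split=> //.
exact: leq_trans Hx.
Qed.

(** The two products are the upward closures of the sources of [A] and of [finv B], and a source
    consists of the idempotents of its upward closure. *)
Lemma composableP A B : proper_filter A -> proper_filter B ->
  composable A B <-> source A = source (finv B).
Proof.
move=> PA PB; have PB' := finv_proper _ PB.
have EB x : fprod B (finv B) x <-> exists e, source (finv B) e /\ e <= x.
  by rewrite -(fprod_finvP _ _ PB') finvK.
split=> [H|H x]; last by rewrite EB -H; exact: fprod_finvP.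
apply: same_eq => e; split=> Ee; have [He _] := Ee.
- have [f [Ef fe]] : exists f, source (finv B) f /\ f <= e.
    by apply/EB/H/fprod_finvP => //; exists e; split=> //; exact: leq_refl.
  exact: (idf_up _ (source_filter _ PB') _ _ Ef).
- have [f [Ef fe]] : exists f, source A f /\ f <= e.
    by apply/fprod_finvP => //; apply/H/EB; exists e; split=> //; exact: leq_refl.
  exact: (idf_up _ (source_filter _ PA) _ _ Ef).
Qed.

(** * Products of composable filters *)

Section Product.
Context (A B : S -> Prop) (PA : proper_filter A) (PB : proper_filter B).
Context (AB : composable A B).

(** By composability [f] is in the source of [finv B], so it can multiply [b^-1] on the right. *)
Lemma source_lmul f b : source A f -> B b -> B (f * b).
Proof.
move=> Ef Bb; have [If _] := Ef; move: Ef.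
rewrite (proj1 (composableP _ _ PA PB) AB) => /(source_mulP _ b^-1 f (finv_proper _ PB)).
rewrite /finv sinvK sinvM sinvK (idem_sinv _ If); exact.
Qed.

Lemma fprodP a b x : A a -> B b ->
  fprod A B x <-> exists e, source B e /\ a * b * e <= x.
Proof.
move=> Aa Bb; split=> [[a1 [b1 [Aa1 [Bb1 Hx]]]]|[e [Ee Hx]]]; last first.
  exists a, (b * e); rewrite mulA; split=> //; split=> //.
  by have [Ie _] := Ee; apply/source_mulP.
have [a2 [Aa2 [a2a a2a1]]] := filter_meet _ _ _ PA Aa Aa1.
have [b2 [Bb2 [b2b b2b1]]] := filter_meet _ _ _ PB Bb Bb1.
(* The domain of [dom a2 * b2] cuts [a * b] down to [a2 * b2], which is below [a1 * b1]. *)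
have Bf : B (dom a2 * b2).
  apply: source_lmul => //; split; first exact: idem_dom.
  by exists a2; split=> //; exact: leq_refl.
exists (dom (dom a2 * b2)); split.
  by split; [exact: idem_dom|exists (dom a2 * b2); split=> //; exact: leq_refl].
have L : dom a2 * b2 <= b by apply: leq_trans b2b; apply/leq_mull/idem_dom.
rewrite -mulA -(leq_eq _ _ L) mulA -(leq_eq _ _ a2a).
by apply: leq_trans Hx; exact: leq_mul.
Qed.

Lemma fprod_mem a b : A a -> B b -> fprod A B (a * b).
Proof. by move=> Aa Bb; exists a, b; split=> //; split=> //; exact: leq_refl. Qed.

Lemma fprod_proper : proper_filter (fprod A B).
Proof.
have [[a Aa] _] := PA; have [[b Bb] _] := PB; have IB := source_filter _ PB.
split; first by exists (a * b); exact: fprod_mem.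
split.
  move=> x y [a1 [b1 [Aa1 [Bb1 Hx]]]] Hxy; exists a1, b1; split=> //; split=> //.
  exact: leq_trans Hxy.
split.
  move=> x y /(fprodP _ _ _ Aa Bb) [e [Ee Hx]] /(fprodP _ _ _ Aa Bb) [f [Ef Hy]].
  have [Ie _] := Ee; have [If _] := Ef.
  exists (a * b * (e * f)); split.
    by apply/(fprodP _ _ _ Aa Bb); exists (e * f); split; [exact: idf_mul|exact: leq_refl].
  by split; [apply: leq_trans Hx|apply: leq_trans Hy]; apply: leq_lmul;
    [exact: leq_mulr|exact: leq_mull].
move=> /(fprodP _ _ _ Aa Bb) [e [Ee /leq_0 H0]]; have [Ie _] := Ee.
apply: (filter_neq0 _ PB).
(* From [a * b * e = 0] it follows that [dom a * (b * e)], an element of [B], is [0]. *)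
rewrite -(smul0r _ a^-1) -H0 !mulA -/(dom a) -mulA; apply: source_lmul.
  by split; [exact: idem_dom|exists a; split=> //; exact: leq_refl].
by apply/source_mulP.
Qed.

Lemma source_fprod : source (fprod A B) = source B.
Proof.
have [[a Aa] _] := PA; have [[b Bb] _] := PB.
apply: same_eq => e; split=> Ee; have [Ie _] := Ee.
- move: Ee => /(source_mulP _ (a * b) e fprod_proper (fprod_mem _ _ Aa Bb) Ie).
  move=> /(fprodP _ _ _ Aa Bb) [f [Ef L]]; have [If _] := Ef.
  apply/(source_mulP _ _ _ PB Bb Ie).
  have Bf : B (dom a * (b * f)).
    apply: source_lmul; last by apply/source_mulP.
    by split; [exact: idem_dom|exists a; split=> //; exact: leq_refl].
  apply: filter_up PB Bf _.
  apply: (leq_trans (dom a * (b * e))); last by apply/leq_mull/idem_dom.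
  by rewrite /dom -!mulA; apply: leq_lmul; rewrite !mulA.
- apply/(source_mulP _ (a * b) e fprod_proper (fprod_mem _ _ Aa Bb) Ie).
  by apply/(fprodP _ _ _ Aa Bb); exists e; split=> //; exact: leq_refl.
Qed.

(** Maximality depends on the source alone, and the product has the source of its right factor. *)
Lemma fprod_ultra : ultrafilter B -> ultrafilter (fprod A B).
Proof.
move=> UB; apply/(ultrafilterP _ fprod_proper); rewrite source_fprod.
exact/ultrafilterP.
Qed.

End Product.

End Filters.

(** * The Cuntz-Krieger ideal and tight filters *)

Definition tight_idem {S : ISG} (E : S -> Prop) : Prop :=
  forall e X, E e -> cover e X -> exists x, In x X /\ E x.

Lemma cover_dom {S : ISG} (a : S) X : cover a X -> cover (dom a) (map dom X).
Proof.
move=> [HX C]; split.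
  by move=> _ /in_map_iff [x [<- /HX]]; exact: leq_dommono.
move=> y y0 ya; have Iy := leq_idem _ _ (idem_dom a) ya.
have Ey : dom (a * y) = y by rewrite dom_mulr //; exact: idem_leqE.
have [|x [Hx [z [z0 [zy zx]]]]] := C (a * y) _ (leq_mulr _ _ Iy).
  by move=> E0; apply: y0; rewrite -Ey E0 /dom smul0r.
exists (dom x); split; first exact: in_map.
exists (dom z); split; first by move=> /dom_eq0.
by split; [rewrite -Ey|]; exact: leq_dommono.
Qed.

(** For a non-zero [y <= a], the idempotent [dom y] meets some [x] in a non-zero [z]; then [y * z]
    lies below [y] and [a * x]. *)
Lemma cover_mul {S : ISG} (a e : S) X : idem e -> dom a <= e ->
  cover e X -> cover a (map (fun x => a * x) X).
Proof.
move=> Ie ae [HX C]; split.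
  move=> _ /in_map_iff [x [<- Hx]]; apply: leq_mulr.
  exact: leq_idem Ie (HX _ Hx).
move=> y y0 ya.
have [|x [Hx [z [z0 [zy zx]]]]] := C (dom y) _ (leq_trans _ _ _ (leq_dommono _ _ ya) ae).
  by move=> /dom_eq0.
have Iz := leq_idem _ _ (idem_dom y) zy.
exists (a * x); split; first exact: (in_map (fun x => a * x)).
exists (y * z); split; last first.
  by split; [exact: leq_mulr|exact: leq_mul].
move=> E0; apply: z0; rewrite -(idem_leqE _ _ Iz zy) /dom -mulA E0; exact: smul0r.
Qed.

(** A non-zero [y] below the conjugate of [f] is carried to [s * y * s^-1] below [f], met there with
    some [x], and the result is carried back. *)
Lemma cover_conj {S : ISG} (s f : S) X : idem f ->
  cover f X -> cover (s^-1 * f * s) (map (fun x => s^-1 * x * s) X).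
Proof.
move=> If [HX C]; split.
  by move=> _ /in_map_iff [x [<- /HX Hx]]; apply/leq_rmul/leq_lmul.
move=> y y0 yf; have Iy := leq_idem _ _ (idem_conj s f If) yf.
have yd : y <= dom s.
  by apply: leq_trans yf _; rewrite /dom; apply/leq_rmul/leq_mulr.
have dy : dom s * y = y by exact: idem_leqE.
have [||x [Hx [z [z0 [zy zx]]]]] := C (s * y * s^-1).
{ move=> E0; apply: y0; rewrite -dy -{1}(idem_dom s) -mulA (idemC _ _ (idem_dom s) Iy).
  by rewrite {1}/dom {1}/dom !mulA -(mulA s^-1) -(mulA s^-1) E0 smul0r smul0l. }
{ apply: leq_trans (leq_rmul _ _ _ (leq_lmul _ _ _ yf)) _.
  rewrite !mulA -/(ran s) -(mulA _ s) -/(ran s).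
  apply: leq_trans (leq_mulr _ _ (idem_ran s)) _.
  exact/leq_mull/idem_ran. }
exists (s^-1 * x * s); split; first exact: (in_map (fun x => s^-1 * x * s)).
have Iz : idem z.
  by apply: leq_idem zx; exact: leq_idem If (HX _ Hx).
have zr : z <= ran s.
  by apply: leq_trans zy _; rewrite /ran; apply/leq_rmul/leq_mulr.
exists (s^-1 * z * s); split; last split.
- move=> E0; apply: z0.
  rewrite -(idem_leqE _ _ Iz zr) -{1}Iz mulA -(mulA _ z z) Iz.
  rewrite -(idem_leqE _ _ Iz zr) (idemC _ _ (idem_ran s) Iz) /ran.
  have -> : s * s^-1 * (z * (s * s^-1)) = s * (s^-1 * z * s) * s^-1 by rewrite !mulA.
  by rewrite E0 smul0r smul0l.
- apply: leq_trans (leq_rmul _ _ _ (leq_lmul _ _ _ zy)) _.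
  rewrite !mulA -/(dom s) -(mulA _ s^-1) -/(dom s).
  apply: leq_trans (leq_mulr _ _ (idem_dom s)) _.
  exact/leq_mull/idem_dom.
- by apply: leq_rmul; apply: leq_lmul.
Qed.

Lemma conj_tight {S : ISG} (s : S) E : tight_idem E -> tight_idem (conj_filter s E).
Proof.
move=> HT f X [If Ef] C.
have [_ [/in_map_iff [x [<- Hx]] Ex]] := HT _ _ Ef (cover_conj s f X If C).
exists x; split=> //; split=> //; exact: leq_idem If (proj1 C _ Hx).
Qed.

Lemma source_tight {S : ISG} (F : S -> Prop) : tight_filter F -> tight_idem (source F).
Proof.
move=> [PF HT] e X [Ie [a [Fa ae]]] C.
have [_ [/in_map_iff [x [<- Hx]] Fx]] := HT _ _ Fa (cover_mul _ _ _ Ie ae C).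
have Ix : idem x by exact: leq_idem Ie (proj1 C _ Hx).
by exists x; split=> //; apply/(source_mulP _ a).
Qed.

Section Completion.
Context {S B T : ISG} (beta : S -> B) (q : B -> T) (HQ : exel_completion S B beta T q).

Let HB : is_booleanization S B beta := proj1 HQ.
Let BB : Boolean B := proj1 HB.
Let bh : hom beta := proj1 (proj2 HB).
Let qh : hom q := proj1 (proj2 HQ).
Let qs : forall t, exists b, q b = t := proj1 (proj2 (proj2 HQ)).
Let qk : forall a b, q a = q b <-> eps_I beta a b := proj2 (proj2 (proj2 HQ)).
Local Notation I := (CK_ideal beta).

Lemma ideal_additive : additive_ideal I.
Proof.
split=> [x s Ix|x y z Ix Iy Hxy Hz].
  by split=> J HJ HG; case: (proj1 HJ x s (Ix J HJ HG)).
by move=> J HJ HG; apply: (proj2 HJ x y z) => //; [exact: Ix|exact: Iy].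
Qed.

Lemma ideal_rmul x s : I x -> I (x * s).
Proof. by move=> /(proj1 ideal_additive x s) []. Qed.

(** [0] is itself a generator: [[0]] covers [0], with difference [0]. *)
Lemma ideal0 : I 0.
Proof.
move=> J _ HG; apply: HG; exists 0, [0], 0; rewrite /= (hom_zero _ bh).
have J0 : forall l : list B, (forall x, In x l -> x = 0) -> is_join l 0.
  by move=> l Hl; split=> [x /Hl ->|b _]; exact: leq0.
split; last split.
- split=> [x [<-|[]]|x x0 /leq_0 //]; exact: leq0.
- by apply: J0 => x [<-|[]].
- split; first exact: leq0.
  split; first exact: leq0.
  split; first by split; rewrite ?smul0l ?smul0r.
  by apply: J0 => x [<-|[<-|[]]].
Qed.

Lemma ideal_join X a : (forall x, In x X -> I x) -> is_join X a -> I a.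
Proof.
apply: join_closed => //; first exact: ideal0.
move=> x y z Ix Iy Hz; apply: (proj2 ideal_additive x y z) => //.
by apply: (is_join_compat _ _ Hz); [left|right; left].
Qed.

Lemma ker_ideal b : q b = 0 <-> I b.
Proof.
rewrite -(hom_zero _ qh) qk; split.
  move=> [c [_ [/leq_0 -> [[x [[_ [_ [_ Hj]]] Ix] _]]]]].
  by apply: ideal_join Hj => y [<-|[<-|[]]] //; exact: ideal0.
have D (x : B) : rel_diff x 0 x.
  split; first exact: leq0.
  split; first exact: leq_refl.
  split; first by split; rewrite ?sinv0 ?smul0r.
  by apply: is_join_two => //; [exact: leq_refl|exact: leq0].
move=> Ib; exists 0; split; first exact: leq0.
split; first exact: leq0.
by split; [exists b|exists 0]; split=> //; exact: ideal0.
Qed.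

Lemma cover_split a X : cover a X -> exists x c,
  is_join (map beta X) c /\ rel_diff (beta a) c x /\ I x.
Proof.
move=> C.
have Xa : forall y, In y (map beta X) -> y <= beta a.
  by move=> _ /in_map_iff [x [<- Hx]]; apply: hom_leq => //; exact: (proj1 C).
have [c Hc] := join_exists BB _ (compat_list_below _ _ Xa).
have [x Hx] := rel_diff_exists BB (beta a) c (proj2 Hc _ Xa).
exists x, c; split=> //; split=> //.
by move=> J _; apply; exists a, X, c.
Qed.

(** The elements vanishing near every tight [E] form an additive ideal containing the generators.
    All [E] are treated at once because a right factor with germ [r] moves [E] to [conj_filter r E],
    again tight. *)
Lemma ideal_tight b E : I b -> idem_filter E -> tight_idem E ->
  exists n, nbhd beta E n /\ b * n = 0.
Proof.
move=> Ib; move: E.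
apply: (Ib (fun b => forall E, idem_filter E -> tight_idem E ->
  exists n, nbhd beta E n /\ b * n = 0)).
- split=> [x s Hx|x y z Hx Hy _ Hz].
  + split=> E HE HT.
      by have [n [Hn H0]] := Hx E HE HT; exists n; split=> //; rewrite -mulA H0 smul0r.
    have [n [Hn [H0|[r [Er [Lr Hr]]]]]] := booleanization_germs beta HB s E HE.
      by exists n; split=> //; rewrite -mulA H0 smul0r.
    have [M [HM M0]] := Hx _ (conj_idem_filter r E HE Er) (conj_tight r E HT).
    have HM' := nbhd_conj beta HB _ _ _ HE Er HM; set M' := _ * M * _ in HM'.
    exists (n * M'); split; first exact: nbhd_mul.
    rewrite -mulA (mulA s) Hr -mulA (idemC _ _ (proj1 Hn) (proj1 HM')) (mulA (beta r)).
    by rewrite -(idem_mul_swap _ _ (proj1 HM)) !mulA M0 !smul0l.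
  + move=> E HE HT; have [n [Hn Hx0]] := Hx E HE HT; have [m [Hm Hy0]] := Hy E HE HT.
    exists (n * m); split; first exact: nbhd_mul.
    apply: is_join_all0 (join_rmul BB (n * m) _ _ (is_join_compat _ _ Hz) Hz) => _ [<-|[<-|[]]].
      by rewrite mulA Hx0 smul0l.
    by rewrite (idemC _ _ (proj1 Hn) (proj1 Hm)) mulA Hy0 smul0l.
- move=> g [a [X [c [C [Hc [_ [ga [[_ gc] _]]]]]]]] E HE HT.
  case: (classic (E (dom a))) => Ea.
  (* Tightness puts [dom x] in [E] for some [x] of the cover; the difference [g] is orthogonal to
     [c], hence to [beta x], and vanishes on [beta (dom x)]. *)
  + have [_ [/in_map_iff [x [<- Hx]] Ex]] := HT _ _ Ea (cover_dom _ _ C).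
    exists (beta (dom x)); split; first exact: nbhd_beta.
    rewrite (hom_mul _ bh) (hom_sinv _ bh) mulA.
    have -> : g * (beta x)^-1 = 0; last exact: smul0l.
    apply: leq_0; rewrite -gc; apply/leq_lmul/leq_sinv.
    by apply: is_join_le Hc _; exact: in_map.
  + have [e He] := idf_ne _ HE.
    have [n [Hn [_ H0]]] := nbhd_avoid beta HB E _ _ (nbhd_beta beta HB E HE _ He) (idem_dom a) Ea.
    exists n; split=> //.
    have <- : g * beta (dom a) = g; last by rewrite -mulA H0 smul0r.
    apply: mulr_dom_le; first by apply: hom_idem => //; exact: idem_dom.
    by rewrite (hom_dom _ bh); exact: leq_dommono.
Qed.

Lemma nbhd_q_neq0 E n : idem_filter E -> tight_idem E -> nbhd beta E n -> q n <> 0.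
Proof.
move=> HE HT Hn /ker_ideal In0.
have [m [Hm H0]] := ideal_tight _ _ In0 HE HT.
by apply: (nbhd_neq0 beta HB E HE); rewrite -H0; exact: nbhd_mul.
Qed.

(** Both [b] and [b'] are joins of a common [c] with an element of the ideal, so both agree with [c]
    near [E]. *)
Lemma ker_germ b b' E : q b = q b' -> idem_filter E -> tight_idem E ->
  exists n, nbhd beta E n /\ b * n = b' * n.
Proof.
move=> /qk [c [_ [_ [[x [[_ [_ [_ Hx]]] Ix]] [y [[_ [_ [_ Hy]]] Iy]]]]]] HE HT.
have [n [Hn H0]] := ideal_tight _ _ Ix HE HT.
have [m [Hm H0']] := ideal_tight _ _ Iy HE HT.
have C : forall d z, is_join [z; c] d -> z * (n * m) = 0 -> d * (n * m) = c * (n * m).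
  move=> d z Hj Z0.
  have := join_rmul BB (n * m) _ _ (is_join_compat _ _ Hj) Hj; rewrite /= Z0 => Hj'.
  apply: leq_antisym; last by apply: is_join_le Hj' _; right; left.
  by apply: (proj2 Hj') => _ [<-|[<-|[]]]; [exact: leq0|exact: leq_refl].
exists (n * m); split; first exact: nbhd_mul.
rewrite (C _ _ Hx); first by rewrite mulA H0 smul0l.
rewrite (C _ _ Hy) //.
by rewrite (idemC _ _ (proj1 Hn) (proj1 Hm)) mulA H0' smul0l.
Qed.

(** * From tight filters to ultrafilters *)

Definition tight_to_ultra (F : S -> Prop) (t : T) : Prop :=
  exists a n, F a /\ nbhd beta (source F) n /\ q (beta a * n) <= t.

Section FromTight.
Context (F : S -> Prop) (HF : tight_filter F).

Let PF : proper_filter F := proj1 HF.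
Let IF : idem_filter (source F) := source_filter F PF.
Let TF : tight_idem (source F) := source_tight F HF.

Lemma source_dom a : F a -> source F (dom a).
Proof.
by move=> Fa; split; [exact: idem_dom|exists a; split=> //; exact: leq_refl].
Qed.

Lemma tight_to_ultra_mem a : F a -> tight_to_ultra F (q (beta a)).
Proof.
move=> Fa; exists a, (beta (dom a)); split=> //; split.
  by apply: nbhd_beta => //; exact: source_dom.
by rewrite -(hom_mul _ bh) mul_dom; exact: leq_refl.
Qed.

Lemma tight_to_ultra_proper : proper_filter (tight_to_ultra F).
Proof.
split; first by have [[a Fa] _] := PF; exists (q (beta a)); exact: tight_to_ultra_mem.
split.
  move=> x y [a [n [Fa [Hn Hx]]]] Hxy; exists a, n; split=> //; split=> //.
  exact: leq_trans Hxy.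
split.
  move=> x y [a [n [Fa [Hn Hx]]]] [b [m [Fb [Hm Hy]]]].
  have [c [Fc [ca cb]]] := filter_meet _ _ _ PF Fa Fb.
  exists (q (beta c * (n * m))); split.
    exists c, (n * m); split=> //; split; first exact: nbhd_mul.
    exact: leq_refl.
  by split; [apply: leq_trans Hx|apply: leq_trans Hy]; apply: hom_leq => //;
    (apply: leq_mul; first exact: hom_leq); [apply/leq_mulr/(proj1 Hm)|apply/leq_mull/(proj1 Hn)].
move=> [a [n [Fa [Hn /leq_0 H0]]]].
have N := nbhd_mul beta HB _ IF _ _ (nbhd_beta beta HB _ IF _ (source_dom _ Fa)) Hn.
apply: (nbhd_q_neq0 _ _ IF TF N).
by rewrite (hom_mul _ bh) -mulA (hom_mul _ qh) H0 smul0r.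
Qed.

Lemma nbhd_source_tight n : nbhd beta (source F) n -> source (tight_to_ultra F) (q n).
Proof.
move=> Hn; have [[a Fa] _] := PF.
apply/(source_mulP _ _ _ tight_to_ultra_proper (tight_to_ultra_mem _ Fa)).
  exact: hom_idem qh _ (proj1 Hn).
rewrite -(hom_mul _ qh); exists a, n; split=> //; split=> //; exact: leq_refl.
Qed.

(** An idempotent of [T] lifts to [f] in [B], which is [0] or everything on some neighbourhood [n];
    as [q n] is in the source, the criterion [ultrafilterP] holds. *)
Lemma tight_to_ultra_ultra : ultrafilter (tight_to_ultra F).
Proof.
apply/(ultrafilterP _ tight_to_ultra_proper) => _ /(hom_idem_lift _ qh qs) [f [If <-]].
have [n [Hn [f0|fn]]] := idem_germ beta HB _ _ IF If; [right|left].
  exists (q n); split; first exact: nbhd_source_tight.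
  by rewrite -(hom_mul _ qh) f0 (hom_zero _ qh).
apply: (idf_up _ (source_filter _ tight_to_ultra_proper) _ _ (nbhd_source_tight _ Hn)).
  exact: hom_idem.
by apply: hom_leq => //; rewrite -fn; apply: leq_mulr; exact: (proj1 Hn).
Qed.

(** The inequality in [T] lifts by [ker_germ] to an equality on a neighbourhood in [B], and
    [nbhd_eq] brings it down to [a * e = s * e] in [S]. *)
Lemma tight_to_ultraK s : tight_to_ultra F (q (beta s)) <-> F s.
Proof.
split; last exact: tight_to_ultra_mem.
move=> [a [n [Fa [Hn Hs]]]].
have Ed : dom (q (beta a * n)) = q (beta (dom a) * n).
  by rewrite -(hom_dom _ qh) dom_mulr ?(hom_dom _ bh) //; exact: (proj1 Hn).
have := leq_eq _ _ Hs; rewrite Ed -(hom_mul _ qh).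
move=> /(fun H => ker_germ _ _ _ H IF TF) [m [Hm Hnm]].
have [|||e [Ee He]] := nbhd_eq beta HB _ IF (beta (dom a) * n * m) a s.
{ by apply: nbhd_mul => //; apply: nbhd_mul => //; apply: nbhd_beta => //; exact: source_dom. }
{ exact: source_dom. }
{ by rewrite !mulA -(hom_mul _ bh) mul_dom Hnm !mulA. }
have [Ie _] := Ee.
apply: (filter_up _ (a * e) _ PF); first exact/source_mulP.
by rewrite He; exact: leq_mulr.
Qed.

End FromTight.

(** * From ultrafilters to tight filters *)

Definition ultra_to_tight (A : T -> Prop) (s : S) : Prop := A (q (beta s)).

(** Defined from [A] directly, so that germs are available before [ultra_to_tight A] is known to be
    a filter; [source_ultra_to_tight] identifies it with the source of the latter. *)
Definition beta_source (A : T -> Prop) (e : S) : Prop := idem e /\ source A (q (beta e)).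

Section FromUltra.
Context (A : T -> Prop) (UA : ultrafilter A).

Let PA : proper_filter A := proj1 UA.
Let IA : idem_filter (source A) := source_filter A PA.

Lemma q_idem f : idem f -> idem (q f).
Proof. exact: hom_idem. Qed.

(** If no [q x] is in [A], maximality gives for each [x] an idempotent of the source disjoint from
    [q (dom x)]. Their product [q g] sends every [x * g], hence the join [b * g], into the ideal, so
    [0] would be in [A]. *)
Lemma ultra_prime L b : is_join L b -> A (q b) -> exists x, In x L /\ A (q x).
Proof.
move=> Hj Ab; apply: NNPP => N.
have [g [Ig [Eg Lg]]] : exists g, idem g /\ source A (q g) /\ forall x, In x L -> I (x * g).
{ have Lb : forall x, In x L -> x <= b by exact: (proj1 Hj).
  elim: L N Lb {Hj} => [|x L IH] N Lb.
    have [e Ee] := idf_ne _ IA; have [f [If Ef]] := hom_idem_lift _ qh qs _ (proj1 Ee).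
    by exists f; rewrite Ef.
  have [||g [Ig [Eg Lg]]] := IH.
    by move=> [y [Hy Ay]]; apply: N; exists y; split=> //; right.
    by move=> y Hy; apply: Lb; right.
  have [|[f [Ef f0]]] := proj1 (ultrafilterP _ PA) UA _ (q_idem _ (idem_dom x)).
    move=> /(source_mulP _ _ _ PA Ab (q_idem _ (idem_dom x))).
    rewrite -(hom_mul _ qh) -(leq_eq _ _ (Lb x (or_introl Logic.eq_refl))) => Ax.
    by case: N; exists x; split=> //; left.
  have [h [Ih Eh]] := hom_idem_lift _ qh qs _ (proj1 Ef); subst f.
  exists (h * g); split; first exact: idemM.
  split; first by rewrite (hom_mul _ qh); exact: idf_mul.
  move=> y [<-|Hy].
  - rewrite mulA; apply: ideal_rmul; apply/ker_ideal.
    by rewrite -(mul_dom x) -mulA (hom_mul _ qh) (hom_mul _ qh (dom x)) f0 smul0r.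
  - by rewrite (idemC _ _ Ih Ig) mulA; apply: ideal_rmul; exact: Lg. }
apply: (filter_neq0 _ PA).
have <- : q (b * g) = 0.
  apply/ker_ideal; apply: ideal_join (join_rmul BB g _ _ (is_join_compat _ _ Hj) Hj).
  by move=> _ /in_map_iff [x [<- /Lg]].
by rewrite (hom_mul _ qh); apply/source_mulP => //; exact: q_idem.
Qed.

Lemma source_prime L f : idem f -> is_join L f -> source A (q f) ->
  exists x, In x L /\ source A (q x).
Proof.
move=> If Hj Ef; have [[t At] _] := PA; have [b Eb] := qs t; subst t.
have Abf : A (q (b * f)) by rewrite (hom_mul _ qh); apply/source_mulP => //; exact: q_idem.
have [_ [/in_map_iff [x [<- Hx]] Abx]] :=
  ultra_prime _ _ (join_lmul BB b _ _ (is_join_compat _ _ Hj) Hj) Abf.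
exists x; split=> //.
apply/(source_mulP _ (q b)) => //; last by rewrite -(hom_mul _ qh).
by apply: q_idem; exact: leq_idem If (is_join_le _ _ _ Hj Hx).
Qed.

Lemma beta_source_filter : idem_filter (beta_source A).
Proof.
split.
- by move=> e [].
- have [[t At] _] := PA; have [b Eb] := qs t; subst t.
  have [L [IL Hj]] := booleanization_bounded beta HB b.
  have [_ [/in_map_iff [e [<- He]] Ae]] := ultra_prime _ _ Hj At.
  exists e; split; first exact: IL.
  apply/(source_mulP _ (q b)) => //; last by rewrite -(hom_mul _ qh).
  by apply/q_idem/hom_idem/IL.
- move=> e f [Ie Ee] If Hef; split=> //; apply: (idf_up _ IA _ _ Ee).
    by apply/q_idem/hom_idem.
  by apply: hom_leq => //; exact: hom_leq.
- move=> e f [Ie Ee] [If Ef]; split; first exact: idemM.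
  by rewrite (hom_mul _ bh) (hom_mul _ qh); exact: idf_mul.
- by move=> [_]; rewrite (hom_zero _ bh) (hom_zero _ qh); exact: idf_0.
Qed.

Lemma beta_source_tight : tight_idem (beta_source A).
Proof.
move=> e X [Ie Ee] C; have [x [c [Hc [[ce [_ [_ Hj]]] Ix]]]] := cover_split _ _ C.
have Ibe : idem (beta e) by exact: hom_idem.
have [_ [[<-|[<-|[]]] Ey]] := source_prime _ _ Ibe Hj Ee.
  by case: (idf_0 _ IA); move/ker_ideal: Ix => <-.
have [_ [/in_map_iff [y [<- Hy]] Ay]] := source_prime _ _ (leq_idem _ _ Ibe ce) Hc Ey.
exists y; split=> //; split=> //; exact: leq_idem Ie (proj1 C _ Hy).
Qed.

(** Split [beta e] into the difference [m] and the parts under the excluded [x]. Primeness selects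
    one piece, and a part under [x] would put [x] in [beta_source A]. *)
Lemma nbhd_source n : nbhd beta (beta_source A) n -> source A (q n).
Proof.
move=> [Hn [e [X [[Ie Ee] [HX H]]]]].
have Ibe : idem (beta e) by exact: hom_idem.
have [m [Im [me [mX Hj]]]] := idem_diff_list beta HB X _ (fun x Hx => proj1 (HX x Hx)) Ibe.
have [_ [[<-|/in_map_iff [x [<- Hx]]] Ey]] := source_prime _ _ Ibe Hj Ee.
  apply: (idf_up _ IA _ _ Ey); first exact: q_idem.
  by apply: hom_leq => //; exact: H.
have [Ix Nx] := HX _ Hx; case: Nx; split=> //.
apply: (idf_up _ IA _ _ Ey); first by apply/q_idem/hom_idem.
by apply: hom_leq => //; exact: leq_mull.
Qed.

Lemma source_nbhdP e :
  source A e <-> idem e /\ exists n, nbhd beta (beta_source A) n /\ q n <= e.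
Proof.
split=> [Ee|[Ie [n [Hn ne]]]]; last exact: (idf_up _ IA _ _ (nbhd_source _ Hn)).
have [Ie _] := Ee; split=> //.
have [h [Ih Eh]] := hom_idem_lift _ qh qs _ Ie; subst e.
have [n [Hn [h0|hn]]] := idem_germ beta HB _ _ beta_source_filter Ih.
  case: (idf_0 _ IA); rewrite -(hom_zero _ qh) -h0 (hom_mul _ qh).
  by apply: idf_mul => //; exact: nbhd_source.
exists n; split=> //; apply: hom_leq => //; rewrite -hn.
by apply/leq_mulr/(proj1 Hn).
Qed.

Lemma ultra_to_tight_proper : proper_filter (ultra_to_tight A).
Proof.
split.
  have [[t At] _] := PA; have [b Eb] := qs t; subst t.
  (* [q (b * n)] is in [A], so the germ of [b] is not zero and supplies an element [s] of [S]. *)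
  have [n [Hn G]] := booleanization_germs beta HB b _ beta_source_filter.
  have An : A (q (b * n)).
    rewrite (hom_mul _ qh); apply/source_mulP => //; last exact: nbhd_source.
    by apply: q_idem; exact: (proj1 Hn).
  case: G => [b0|[s [_ [_ bs]]]].
    by case: (filter_neq0 _ PA); rewrite -(hom_zero _ qh) -b0.
  exists s; apply: filter_up PA An _; rewrite bs; apply: hom_leq => //.
  by apply/leq_mulr/(proj1 Hn).
split.
  by move=> x y Ax Hxy; apply: filter_up PA Ax _; apply: hom_leq => //; exact: hom_leq.
split; last first.
  by rewrite /ultra_to_tight (hom_zero _ bh) (hom_zero _ qh); exact: filter_neq0.
move=> x y Ax Ay; have [w [Aw [wx wy]]] := filter_meet _ _ _ PA Ax Ay.
have Ew : source A (dom w).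
  by split; [exact: idem_dom|exists w; split=> //; exact: leq_refl].
have [_ [n [Hn nw]]] := proj1 (source_nbhdP _) Ew.
have In0 := proj1 Hn.
have wn : dom w * q n = q n by apply: idem_leqE => //; exact: q_idem.
(* Since [q n <= dom w], both sides restrict [w]. Lifting to [B] and then to [S] gives
   [x * e = y * e], the required lower bound. *)
have Exy : q (beta x * n) = q (beta y * n).
  by rewrite !(hom_mul _ qh) -wn !(mulA _ (dom w)) -(leq_eq _ _ wx) -(leq_eq _ _ wy).
have [m [Hm Hnm]] := ker_germ _ _ _ Exy beta_source_filter beta_source_tight.
have [|||e [[Ie Ee] He]] := nbhd_eq beta HB _ beta_source_filter (n * m) x y.
{ by apply: nbhd_mul => //; exact: beta_source_filter. }
{ split; first exact: idem_dom.
  split; first by apply/q_idem/hom_idem/idem_dom.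
  exists (q (beta x)); split=> //; rewrite (hom_dom _ bh) (hom_dom _ qh); exact: leq_refl. }
{ by rewrite !mulA. }
exists (x * e); split.
  rewrite /ultra_to_tight (hom_mul _ bh) (hom_mul _ qh); apply/source_mulP => //.
  by apply/q_idem/hom_idem.
by split; [|rewrite He]; exact: leq_mulr.
Qed.

Lemma ultra_to_tight_tight : tight_filter (ultra_to_tight A).
Proof.
split; first exact: ultra_to_tight_proper.
move=> a X Aa C; have [x [c [Hc [[_ [_ [_ Hj]]] Ix]]]] := cover_split _ _ C.
have [_ [[<-|[<-|[]]] Ay]] := ultra_prime _ _ Hj Aa.
  by case: (filter_neq0 _ PA); move/ker_ideal: Ix => <-.
have [_ [/in_map_iff [y [<- Hy]] Ay']] := ultra_prime _ _ Hc Ay.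
by exists y.
Qed.

Lemma source_ultra_to_tight : source (ultra_to_tight A) = beta_source A.
Proof.
have PT := ultra_to_tight_proper; have [[s As] _] := PT.
have K : forall e, idem e -> source (ultra_to_tight A) e <-> source A (q (beta e)).
  move=> e Ie; rewrite (source_mulP _ _ _ PT As Ie) /ultra_to_tight (hom_mul _ bh) (hom_mul _ qh).
  by symmetry; apply: source_mulP => //; apply/q_idem/hom_idem.
apply: same_eq => e; split=> [Ee|[Ie /K]]; last by apply.
by have [Ie _] := Ee; split=> //; apply/K.
Qed.

(** One inclusion is direct; the other is the maximality of the ultrafilter on the left. *)
Lemma ultra_to_tightK t : tight_to_ultra (ultra_to_tight A) t <-> A t.
Proof.
have Sub : forall t, tight_to_ultra (ultra_to_tight A) t -> A t.
  move=> u [a [n [Aa [Hn Hu]]]]; apply: filter_up PA _ Hu; rewrite (hom_mul _ qh).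
  apply/source_mulP => //; first by apply/q_idem/(proj1 Hn).
  by apply: nbhd_source; rewrite -source_ultra_to_tight.
split; first exact: Sub.
have [_ U] := tight_to_ultra_ultra _ ultra_to_tight_tight.
exact: U PA Sub t.
Qed.

End FromUltra.

(** * Compatibility of the bijection with products and topologies *)

Lemma ultra_to_tight_finv A : ultra_to_tight (finv A) = finv (ultra_to_tight A).
Proof.
by apply: same_eq => s; rewrite /ultra_to_tight /finv (hom_sinv _ bh) (hom_sinv _ qh).
Qed.

(** Composability compares sources, and [source A] and [beta_source A] determine each other through
    [source_nbhdP]. *)
Lemma ultra_to_tight_composable A A' : ultrafilter A -> ultrafilter A' ->
  composable A A' <-> composable (ultra_to_tight A) (ultra_to_tight A').
Proof.
move=> UA UA'; have UV := finv_ultra _ UA'.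
rewrite !composableP; try by [apply: ultra_proper|apply: ultra_to_tight_proper].
rewrite -ultra_to_tight_finv !source_ultra_to_tight //.
split=> H; first by apply: same_eq => e; rewrite /beta_source H.
by apply: same_eq => e; rewrite !source_nbhdP // H.
Qed.

Lemma ultra_to_tight_fprod A A' : ultrafilter A -> ultrafilter A' -> composable A A' ->
  same (ultra_to_tight (fprod A A')) (fprod (ultra_to_tight A) (ultra_to_tight A')).
Proof.
move=> UA UA' C x; have PA := ultra_proper _ UA; have PA' := ultra_proper _ UA'.
have UP := fprod_ultra _ _ PA PA' C UA'; split.
- move=> Px; have PP := ultra_to_tight_proper _ UP.
  have [[a Aa] _] := ultra_to_tight_proper _ UA.
  have [[b Ab] _] := ultra_to_tight_proper _ UA'.
  have Pab : ultra_to_tight (fprod A A') (a * b).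
    by rewrite /ultra_to_tight (hom_mul _ bh) (hom_mul _ qh); exact: fprod_mem.
  have [w [Pw [wx wab]]] := filter_meet _ _ _ PP Px Pab.
  have : source (ultra_to_tight (fprod A A')) (dom w).
    by split; [exact: idem_dom|exists w; split=> //; exact: leq_refl].
  rewrite source_ultra_to_tight // => -[Id]; rewrite source_fprod // => Ed.
  exists a, (b * dom w); split=> //; split.
    rewrite /ultra_to_tight (hom_mul _ bh) (hom_mul _ qh); apply/source_mulP => //.
    by apply/q_idem/hom_idem.
  by rewrite mulA -(leq_eq _ _ wab).
- move=> [a [b [Aa [Ab Hx]]]]; exists (q (beta a)), (q (beta b)); split=> //; split=> //.
  by rewrite -(hom_mul _ qh) -(hom_mul _ bh); apply: hom_leq => //; exact: hom_leq.
Qed.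

Lemma ultra_to_tight_continuous a X : (forall x, In x X -> x <= a) ->
  stone_open (fun A => patch_basic a X (ultra_to_tight A)).
Proof.
move=> HX A UA [Aa NX].
have Xa : forall y, In y (map beta X) -> y <= beta a.
  by move=> _ /in_map_iff [x [<- Hx]]; apply: hom_leq => //; exact: HX.
have [c Hc] := join_exists BB _ (compat_list_below _ _ Xa).
have [b [_ [ba [[_ bc] Hj]]]] := rel_diff_exists BB (beta a) c (proj2 Hc _ Xa).
(* [b] is [beta a] minus the join of the [beta x]; primeness puts [q b] in [A], and orthogonality of
   [b] and [c] excludes every [x] from the other ultrafilters containing [q b]. *)
exists (q b); split.
  have [_ [[<-|[<-|[]]] Ay]] // := ultra_prime _ UA _ _ Hj Aa.
  have [_ [/in_map_iff [y [<- Hy]] Ay']] := ultra_prime _ UA _ _ Hc Ay.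
  by case: (NX _ Hy).
move=> A' UA' Ab; have PA' := ultra_proper _ UA'; split.
  by apply: filter_up PA' Ab _; exact: hom_leq.
move=> x Hx Ax; have [w [Aw [wb wx]]] := filter_meet _ _ _ PA' Ab Ax.
apply: (filter_neq0 _ PA'); suff <- : w = 0 by [].
have wc : w <= q c.
  by apply: leq_trans wx _; apply: hom_leq => //; apply: is_join_le Hc _; exact: in_map.
have R0 : ran w = 0.
  apply: leq_0; rewrite -(hom_zero _ qh) -bc (hom_mul _ qh) (hom_sinv _ qh).
  by apply: leq_mul => //; exact: leq_sinv.
by rewrite -(mul_ran w) R0 smul0l.
Qed.

Lemma tight_to_ultra_continuous t : patch_open (fun F => tight_to_ultra F t).
Proof.
move=> F HF [a [n [Fa [[In0 [e [X [Ee [HX H]]]]] Ht]]]]; have PF := proj1 HF.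
have [Ie _] := Ee.
have Fae : F (a * e) by apply/source_mulP.
(* By [source_mulP], this patch set expresses that [e] is in the source and each excluded [x] is
   not; hence [n] is also a neighbourhood of the source of every [G] in it. *)
exists (a * e), (map (fun x => a * e * x) X); split.
  by move=> _ /in_map_iff [x [<- /HX [Ix _]]]; exact: leq_mulr.
split.
  split=> // _ /in_map_iff [x [<- /HX [Ix Nx]]] Fx; apply: Nx.
  exact/(source_mulP _ _ _ PF Fae Ix).
move=> G HG [Gae NX]; have PG := proj1 HG.
exists a, n; split; first by apply: filter_up PG Gae _; exact: leq_mulr.
split=> //; split=> //; exists e, X; split.
  split=> //; exists (a * e); split=> //; rewrite dom_mulr //.
  by apply/leq_mull/idem_dom.
split=> // x Hx; have [Ix _] := HX _ Hx; split=> // Ex.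
apply: (NX (a * e * x)); first exact: (in_map (fun x => a * e * x)).
exact/(source_mulP _ _ _ PG Gae Ix).
Qed.

End Completion.

Theorem theorem1p4 (S B T : ISG) (beta : S -> B) (q : B -> T) :
  exel_completion S B beta T q -> stone_tight_iso S T.
Proof.
move=> HQ; exists (ultra_to_tight beta q), (tight_to_ultra beta q).
split; first exact: ultra_to_tight_tight.
split; first exact: tight_to_ultra_ultra.
split; first by move=> A A' /same_eq ->.
split; first by move=> F F' /same_eq ->.
split; first by move=> A UA t; exact: ultra_to_tightK.
split; first by move=> F HF s; exact: tight_to_ultraK.
split; first exact: ultra_to_tight_composable.
split; first exact: ultra_to_tight_fprod.
split; first exact: ultra_to_tight_continuous.
exact: tight_to_ultra_continuous.
Qed.
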